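(* Assume that $(\mathbb{X},\mathcal{X})$ is a Borel space and that $\rho$ is a diffuse measure on $\mathbb{X}$ with $0<\rho(\mathbb{X})<\infty$. Let $\zeta$ be a Dirichlet process with parameter measure $\rho$ and let $\tau$ be a random element of $\mathbb{X}$ satisfying $\mathbb{P}(\tau\in B\mid\zeta)=\zeta(B)$ almost surely for each $B\in\mathcal{X}$. Then $\zeta^{(\tau)}\overset{d}{=}\zeta$. Moreover, $\zeta^{(\tau)}$, $\zeta\{\tau\}$ and $\tau$ are independent.
   Context: For a measure $\mu$ on a Borel space $\mathbb{X}$ and $x\in\mathbb{X}$, write $\mu\{x\}:=\mu(\{x\})$ and $$\mu^{(x)}:=(1-\mu\{x\})^{-1}(\mu-\mu\{x\}\delta_x),$$ where $a/0:=0$ for all $a\in\mathbb{R}$ (this is effectively used only for probability measures $\mu$ with $\mu\{x\}<1$ for all $x$). A measure $\rho$ is diffuse if $\rho\{x\}=0$ for all $x\in\mathbb{X}$. $\overset{d}{=}$ denotes equality in distribution. $\mathbf{M}$ denotes the space of all $s$-finite measures (countable sums of finite measures) on $(\mathbb{X},\mathcal{X})$, equipped with the smallest $\sigma$-field making the mappings $\mu\mapsto\mu(B)$ measurable for each $B\in\mathcal{X}$. A random measure on $\mathbb{X}$ is a random element of $\mathbf{M}$ defined on a probability space $(\Omega,\mathcal{F},\mathbb{P})$. Dirichlet distribution: for $n\ge 1$ and $\alpha_1,\dots,\alpha_n\in[0,\infty)$ with $\alpha_1+\cdots+\alpha_n>0$, $\mathrm{Dir}(\alpha_1,\dots,\alpha_n)$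 is the probability measure on $\Delta_n:=\{(p_1,\dots,p_n)\in[0,1]^n:p_1+\dots+p_n=1\}$ defined as follows. If $n\ge 2$ and all $\alpha_i>0$, it has density $(x_1,\dots,x_n)\mapsto \frac{\Gamma(\alpha_1+\dots+\alpha_n)}{\Gamma(\alpha_1)\cdots\Gamma(\alpha_n)}x_1^{\alpha_1-1}\cdots x_n^{\alpha_n-1}$ with respect to Lebesgue measure on $\Delta_n$ (parametrized by the first $n-1$ coordinates). If $n=1$, $\mathrm{Dir}(\alpha_1):=\delta_1$. If $n\ge2$ and some of the $\alpha_i$ vanish, the corresponding coordinates are equal to $0$ and the remaining coordinates have the Dirichlet distribution with the remaining (positive) parameters. A random measure $\zeta$ on $\mathbb{X}$ is called a Dirichlet process with parameter measure $\rho$ if $(\zeta(B_1),\ldots,\zeta(B_n))$ has distribution $\mathrm{Dir}(\rho(B_1),\ldots,\rho(B_n))$ whenever $B_1,\ldots,B_n$, $n\ge1$, form a measurable partition of $\mathbb{X}$. Since $\mathbb{X}$ is a Borel space, $\zeta$ may be taken to be a random probability measure. *)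

(* Defs.v *)
From HB Require Import structures.
From mathcomp Require Import all_boot all_order all_algebra.
From mathcomp Require Import all_classical all_reals all_analysis.
From mathcomp Require Import measurable_realfun.

Set Implicit Arguments.
Unset Strict Implicit.
Unset Printing Implicit Defensive.
Import Order.TTheory GRing.Theory Num.Theory.
Import numFieldNormedType.Exports.

Local Open Scope classical_set_scope.
Local Open Scope ring_scope.
Local Open Scope ereal_scope.

(* X is isomorphic, as a measurable space, to a Borel subset of [0, 1]. *)
Definition borel_space (R : realType) d (X : measurableType d) : Prop :=
  exists (f : X -> R) (g : R -> X),
    [/\ measurable (range f), range f `<=` `[0%R, 1%R],
        measurable_fun setT f, measurable_fun (range f) g & cancel f g].

Definition diffuse (R : realType) d (X : measurableType d)
  (rho : set X -> \bar R) : Prop := forall x, rho [set x] = 0.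

Section sfmeas.
Context d (X : measurableType d) (R : realType).

Definition sfmeas : Type := {sfinite_measure set X -> \bar R}.

HB.instance Definition _ := gen_eqMixin sfmeas.
HB.instance Definition _ := gen_choiceMixin sfmeas.
HB.instance Definition _ := isPointed.Build sfmeas mzero.

Definition sfmeas_ev (mu : sfmeas) (B : set X) : \bar R := mu B.

Definition sfmeas_measurable : set (set sfmeas) :=
  <<s \bigcup_(B in measurable)
        preimage_set_system setT (sfmeas_ev ^~ B) measurable >>.

Let sfmeas0 : sfmeas_measurable set0.
Proof. exact: sigma_algebra0. Qed.

Let sfmeasC (U : set sfmeas) :
  sfmeas_measurable U -> sfmeas_measurable (~` U).
Proof. exact: sigma_algebraC. Qed.

Let sfmeasU (F : (set sfmeas)^nat) :
  (forall i, sfmeas_measurable (F i)) -> sfmeas_measurable (\bigcup_i F i).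
Proof. exact: sigma_algebra_bigcup. Qed.

Definition sfmeas_display : measure_display.
Proof. exact default_measure_display. Qed.

HB.instance Definition _ := @isMeasurable.Build sfmeas_display sfmeas
  sfmeas_measurable sfmeas0 sfmeasC sfmeasU.

End sfmeas.

(* The measure (1 - mu{x})^-1 (mu - mu{x} delta_x). The formula defines a
   (nonnegative) measure only when mu{x} <= 1, which always holds when mu is a
   probability measure; the zero measure is used as a default otherwise. The
   division convention a / 0 = 0 is the one of MathComp. The test on B is
   needed because library measures are total functions that are nonnegative on
   all sets, whereas the difference is only known to be so on measurable
   ones. *)
Section del_atom.
Context d (X : measurableType d) (R : realType).
Variables (mu : sfmeas X R) (x : X).

Definition del_atom_fun (B : set X) : \bar R :=
  if `[< [/\ measurable [set x], mu [set x] <= 1 & measurable B] >] then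
    ((1 - fine (mu [set x]))^-1)%:E * (mu B - mu [set x] * \d_x B)
  else 0.

Let c_ge0 : mu [set x] <= 1 -> (0 <= (1 - fine (mu [set x]))^-1)%R.
Proof.
move=> mux1; rewrite invr_ge0 subr_ge0 -lee_fin fineK//.
by rewrite ge0_fin_numE//; exact: le_lt_trans mux1 (ltry _).
Qed.

Let del_atom_setD (B : set X) :
  measurable [set x] -> mu [set x] <= 1 -> measurable B ->
  mu B - mu [set x] * \d_x B = mu (B `&` ~` [set x]).
Proof.
move=> mx mux1 mB.
have fx : mu [set x] \is a fin_num.
  by rewrite ge0_fin_numE//; exact: le_lt_trans mux1 (ltry _).
have mD : measurable (B `\ x) by exact: measurableD.
rewrite -setDE diracE; have [xB|xB] := boolP (x \in B).
  rewrite mule1 -[in LHS](@setDKU _ [set x] B); last first.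
    by move=> _ ->; exact/set_mem.
  rewrite measureU//; first by rewrite addeK.
  by rewrite setDE -setIA setICl setI0.
rewrite mule0 sube0 not_setD1// => /mem_set xB'.
by rewrite xB' in xB.
Qed.

Let del_atomE (mx : measurable [set x]) (mux1 : mu [set x] <= 1) (B : set X) :
  measurable B -> del_atom_fun B =
  mscale (NngNum (c_ge0 mux1)) (mrestr mu (measurableC mx)) B.
Proof.
move=> mB; rewrite /del_atom_fun asboolT//.
by rewrite del_atom_setD.
Qed.

Let del_atom_default B : ~ (measurable [set x] /\ mu [set x] <= 1) ->
  del_atom_fun B = 0.
Proof.
by move=> h; rewrite /del_atom_fun; case: asboolP => // -[mx mux1 _]; case: h.
Qed.

Let del_atom0 : del_atom_fun set0 = 0.
Proof.
rewrite /del_atom_fun; case: ifPn => // /asboolP[mx mux1 _].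
by rewrite del_atom_setD// set0I measure0 mule0.
Qed.

Let del_atom_ge0 B : 0 <= del_atom_fun B.
Proof.
rewrite /del_atom_fun; case: ifPn => // /asboolP[mx mux1 mB].
by rewrite del_atom_setD// mule_ge0// lee_fin c_ge0.
Qed.

Let del_atom_sigma_additive : semi_sigma_additive del_atom_fun.
Proof.
move=> F mF tF mUF.
have [[mx mux1]|h] := pselect (measurable [set x] /\ mu [set x] <= 1).
  rewrite del_atomE//; under eq_fun do under eq_bigr do rewrite del_atomE//.
  exact: measure_semi_sigma_additive.
rewrite del_atom_default//.
by under eq_fun do (rewrite big1; last by move=> ? _; rewrite del_atom_default);
  exact: cvg_cst.
Qed.

HB.instance Definition _ := isMeasure.Build _ _ _ del_atom_fun
  del_atom0 del_atom_ge0 del_atom_sigma_additive.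

Let del_atom_sfinite : sfinite_measure del_atom_fun.
Proof.
have [[mx mux1]|h] := pselect (measurable [set x] /\ mu [set x] <= 1); last first.
  exists (fun=> mzero) => // U mU.
  by rewrite del_atom_default// /mseries eseries0.
pose c := NngNum (c_ge0 mux1).
exists (fun n => mscale c (mrestr (sfinite_measure_seq mu n) (measurableC mx))).
  move=> n U mU; rewrite /= /mscale/= /mrestr fin_numM//.
  by apply: (fin_num_measure (sfinite_measure_seq mu n));
    by apply: measurableI => //; exact: measurableC.
move=> U mU; rewrite del_atomE// /mscale /mrestr/=.
have mUx : measurable (U `&` ~` [set x]).
  by apply: measurableI => //; exact: measurableC.
rewrite /mseries nneseriesZl//; congr (_ * _).
exact: (sfinite_measure_seqP mu mUx).
Qed.

HB.instance Definition _ := isSFinite.Build _ _ _ del_atom_fun del_atom_sfinite.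

Definition del_atom : sfmeas X R := del_atom_fun.

Lemma del_atom_prob (B : set X) :
  measurable [set x] -> mu setT = 1 -> measurable B ->
  del_atom B = ((1 - fine (mu [set x]))^-1)%:E * (mu B - mu [set x] * \d_x B).
Proof.
move=> mx mu1 mB; rewrite /del_atom/= /del_atom_fun asboolT//.
by split => //; rewrite -mu1 le_measure// inE.
Qed.

End del_atom.

Section dirichlet.
Context (R : realType).

Definition Gamma (a : R) : R :=
  fine (\int[lebesgue_measure]_(x in `]0%R, +oo[) (x `^ (a - 1) * expR (- x))%:E).

(* n-dimensional Lebesgue measure, as an iterated product. *)
Fixpoint lebesgue_tuple (n : nat) : set (n.-tuple R) -> \bar R :=
  match n with
  | 0%N => \d_[tuple]
  | m.+1 => pushforward (lebesgue_measure \x @lebesgue_tuple m)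
              (fun p : R * m.-tuple R => [tuple of p.1 :: p.2])
  end.

Definition simplex n : set (n.-tuple R) :=
  [set p | (forall i, (0 <= tnth p i <= 1)%R) /\
           (\sum_(i < n) tnth p i = 1)%R].

(* The point of the hyperplane sum_i p_i = 1 with the given first m
   coordinates. *)
Definition simplex_point m (x : m.-tuple R) : m.+1.-tuple R :=
  [tuple of rcons x (1 - \sum_(i < m) tnth x i)%R].

Definition dirichlet_density n (a p : n.-tuple R) : R :=
  (Gamma (\sum_(i < n) tnth a i) / (\prod_(i < n) Gamma (tnth a i)) *
   \prod_(i < n) tnth p i `^ (tnth a i - 1))%R.

(* Dirichlet distribution with positive parameters (n = 0 is a dummy case). *)
Definition dirichlet_pos n : n.-tuple R -> set (n.-tuple R) -> \bar R :=
  match n return n.-tuple R -> set (n.-tuple R) -> \bar R with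
  | 0%N => fun _ _ => 0
  | 1%N => fun _ => \d_([tuple 1%R] : 1.-tuple R)
  | (_.+1 as m).+1 => fun a A =>
      \int[@lebesgue_tuple m]_(x in [set x | (@simplex m.+1 `&` A) (simplex_point x)])
        (dirichlet_density a (simplex_point x))%:E
  end.

(* Puts the successive entries of p at the positions where a is positive, and
   0 at the others. *)
Definition pos_embed n (a : n.-tuple R) k (p : k.-tuple R) : n.-tuple R :=
  [tuple if (0 < tnth a i)%R
         then nth 0%R p (count (fun y => (0 < y)%R) (take i a))
         else 0%R | i < n].

(* Dir(a_1, ..., a_n) for nonnegative parameters with positive sum. *)
Definition dirichlet n (a : n.-tuple R) : set (n.-tuple R) -> \bar R :=
  pushforward (dirichlet_pos (in_tuple [seq y <- a | (0 < y)%R]))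
              (@pos_embed n a _).

End dirichlet.

Section random_elements.
Context (R : realType) dO (Omega : measurableType dO) (P : probability Omega R).

Definition is_dirichlet_process d (X : measurableType d)
    (rho : set X -> \bar R) (zeta : Omega -> sfmeas X R) : Prop :=
  forall n (B : 'I_n -> set X), (0 < n)%N ->
    (forall i, measurable (B i)) -> trivIset setT B ->
    \bigcup_i B i = setT ->
    forall A : set (n.-tuple (\bar R)), measurable A ->
      pushforward P (fun w => [tuple zeta w (B i) | i < n]) A =
      pushforward (dirichlet [tuple fine (rho (B i)) | i < n])
        (fun p => [tuple of map EFin p]) A.

(* Y is a version of the conditional probability of the event E given the
   sigma-algebra generated by Z. *)
Definition is_cond_prob d (T : measurableType d) (E : set Omega)
    (Z : Omega -> T) (Y : Omega -> \bar R) : Prop :=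
  (forall C : set (\bar R), measurable C ->
     preimage_set_system setT Z measurable (Y @^-1` C)) /\
  (forall A : set T, measurable A ->
     \int[P]_(w in Z @^-1` A) Y w = P (E `&` Z @^-1` A)).

Definition eq_dist d (T : measurableType d) (U V : Omega -> T) : Prop :=
  forall A, measurable A -> pushforward P U A = pushforward P V A.

(* Pairwise independence is the case where one of the sets is setT. *)
Definition independent3 d1 d2 d3 (T1 : measurableType d1)
    (T2 : measurableType d2) (T3 : measurableType d3)
    (U : Omega -> T1) (V : Omega -> T2) (W : Omega -> T3) : Prop :=
  forall A B C, measurable A -> measurable B -> measurable C ->
    P (U @^-1` A `&` V @^-1` B `&` W @^-1` C) =
    P (U @^-1` A) * P (V @^-1` B) * P (W @^-1` C).

End random_elements.

(* Main.v *)
Require Import Defs.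
From HB Require Import structures.
From mathcomp Require Import all_boot all_order all_algebra.
From mathcomp Require Import all_classical all_reals all_analysis.
From mathcomp Require Import measurable_realfun.
From mathcomp Require Import perm ring.

(** For a Dirichlet vector [p] with parameters [a] of sum [theta], the measure
    [p_j Dir(a)(dp)] is [a_j / theta] times the law of [s p + (1 - s) e_j],
    where [s] is independent of [p] with density [theta s^(theta - 1)] on
    [(0, 1)]. To see this for the last index, scale the other coordinates by
    [s]: all powers of [s] cancel in the density, and what remains is the
    integral of [alpha (s - sigma)^(alpha - 1)] over [(sigma, 1)], which is
    [(1 - sigma)^alpha]; the Gamma factors play no role.
    Applied to all finite partitions, this says that [(zeta, tau)] has the
    law of [(s zeta + (1 - s) delta_x, x)] where [x], [s] and [zeta] are
    independent and [x] has law [rho / theta]. Since [rho] is diffuse,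
    [zeta{x} = 0] almost surely for each fixed [x], so that removing the atom
    at [x] from [s zeta + (1 - s) delta_x], which has mass [1 - s], gives back
    [zeta]. *)

Set Implicit Arguments.
Unset Strict Implicit.
Unset Printing Implicit Defensive.
Import Order.TTheory GRing.Theory Num.Theory.
Import numFieldNormedType.Exports.

Local Open Scope classical_set_scope.
Local Open Scope ring_scope.
Local Open Scope ereal_scope.

(** The two ingredients of the mixture are kept unnormalized: [rho] has mass [theta] and
    [beta_measure] has mass [1 / theta], so the product of [rho], [beta_measure] and [P] already has
    mass one. The passage from partitions to measures goes through products of a cylinder with a
    measurable set of [X], which form a generating system closed under intersection. The finitely
    many sets involved need not be disjoint and are replaced by the cells of the finite algebra they
    generate. Some cells may be empty or null for [rho], so the size-biasing identity has to cover
    vanishing parameters too. The last index is special because the simplex is parametrized by the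
    other coordinates; any other index is reached by permuting the partition. That [zeta] has no
    atom at a fixed [x] comes from the same joint law, since the mean of [zeta B] is [P(tau in B)],
    which is proportional to [rho B]. The exceptional null set depends on [x], hence [x] and [s]
    stay fixed while the probability over [zeta] is computed. That probability splits into factors
    depending on [x], on [s] and on the law of [zeta], which yields independence and the law of the
    remainder together. *)

(** * Integration against densities and image measures *)

Section density_measure.
Context d (T : measurableType d) (R : realType).
Variables (mu : {measure set T -> \bar R}) (f : T -> R).
Hypotheses (f0 : forall x, (0 <= f x)%R) (mf : measurable_fun setT f).

Definition mdensity (A : set T) : \bar R := \int[mu]_(x in A) (f x)%:E.

Let mdensity0 : mdensity set0 = 0.
Proof. exact: integral_set0. Qed.

Let mdensity_ge0 A : 0 <= mdensity A.
Proof. by apply: integral_ge0 => x _; exact: f0. Qed.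

Let mdensity_sigma_additive : semi_sigma_additive mdensity.
Proof.
move=> F mF tF mUF; rewrite /mdensity ge0_integral_bigcup//; last 2 first.
  - exact/measurable_EFinP/measurable_funTS.
  - by move=> x _; rewrite lee_fin.
by apply: is_cvg_ereal_nneg_natsum => n _; exact: mdensity_ge0.
Qed.

HB.instance Definition _ := isMeasure.Build _ _ _ mdensity
  mdensity0 mdensity_ge0 mdensity_sigma_additive.

Definition density_measure : {measure set T -> \bar R} := mdensity.

Import HBNNSimple.

(** Monotone convergence reduces the identity to simple functions and linearity to indicators of
    level sets, for which both sides are integrals of [f]. *)
Lemma ge0_integral_density_measure (g : T -> \bar R) (E : set T) :
  measurable E -> (forall x, 0 <= g x) -> measurable_fun setT g ->
  \int[density_measure]_(x in E) g x = \int[mu]_(x in E) (g x * (f x)%:E).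
Proof.
move=> mE g0 mg; pose h := nnsfun_approx measurableT mg.
have hmono x : {homo (fun n => (h n x)%:E) : a b / (a <= b)%N >-> a <= b}.
  by move=> a b ab; rewrite lee_fin; exact/lefP/nd_nnsfun_approx.
have mh n : measurable_fun setT (fun x => (h n x)%:E).
  exact/measurable_EFinP/measurable_funP.
have hg x : (h n x)%:E @[n --> \oo] --> g x by exact: cvg_nnsfun_approx.
transitivity (limn (fun n => \int[density_measure]_(x in E) (h n x)%:E)).
  rewrite -monotone_convergence//.
  - by apply: eq_integral => x _; apply/esym/cvg_lim.
  - by move=> n; exact: measurable_funTS.
  - by move=> n x _; rewrite lee_fin.
transitivity (limn (fun n => \int[mu]_(x in E) ((h n x)%:E * (f x)%:E)));
  last first.
  rewrite -monotone_convergence//.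
  - apply: eq_integral => x _; apply/cvg_lim => //.
    by apply: cvgeZr => //; exact: hg.
  - move=> n; apply: measurable_funTS.
    by apply: emeasurable_funM => //; exact/measurable_EFinP.
  - by move=> n x _; rewrite mule_ge0 ?lee_fin.
  - move=> x _ a b ab; apply: lee_wpmul2r; first by rewrite lee_fin.
    exact: hmono.
apply: congr_lim; apply/funext => n.
transitivity (\int[density_measure]_(x in E)
    (\sum_(r \in range (h n)) (r * \1_(h n @^-1` [set r]) x)%:E)).
  by apply: eq_integral => x _; rewrite fsumEFin// -fimfunE.
rewrite ge0_integral_fsum//; last 2 first.
  - move=> r; apply: measurable_funTS; apply/measurable_EFinP.
    exact: measurable_funM.
  - by move=> r x _; exact: nnfun_muleindic_ge0.
transitivity (\int[mu]_(x in E)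
    (\sum_(r \in range (h n)) ((r * \1_(h n @^-1` [set r]) x)%:E * (f x)%:E))).
  rewrite ge0_integral_fsum//; last 2 first.
  - move=> r; apply: measurable_funTS; apply: emeasurable_funM => //.
      by apply/measurable_EFinP/measurable_funM.
    exact/measurable_EFinP.
  - by move=> r x _; rewrite mule_ge0 ?lee_fin//; exact: nnfun_muleindic_ge0.
  apply: eq_fsbigr => r; rewrite inE => -[y _ <-{r}].
  rewrite integralZl_indic_nnsfun// integral_indic//.
  under eq_integral do rewrite EFinM -muleA.
  rewrite ge0_integralZl//; last 3 first.
  - apply: measurable_funTS; apply: emeasurable_funM; exact/measurable_EFinP.
  - by move=> x _; rewrite mule_ge0 ?lee_fin.
  - by rewrite lee_fin.
  congr (_ * _); rewrite setIC [LHS]integral_mkcondr.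
  apply: eq_integral => x _.
  by rewrite epatch_indic muleC.
apply: eq_integral => x _; rewrite [in RHS]fimfunE -fsumEFin//.
by rewrite ge0_mule_fsuml// => r; exact: nnfun_muleindic_ge0.
Qed.

End density_measure.

Section pushforward_measure.
Context d1 d2 (T1 : measurableType d1) (T2 : measurableType d2) (R : realType).
Variables (m : {measure set T1 -> \bar R}) (f : T1 -> T2).
Hypothesis mf : measurable_fun setT f.

Definition pushforward_measure : {measure set T2 -> \bar R} :=
  ltac:(unshelve refine (pushforward m f : {measure set T2 -> \bar R});
    exact: mf).

Lemma pushforward_measureE A : pushforward_measure A = m (f @^-1` A).
Proof. by []. Qed.

Lemma ge0_integral_pushforward_measure (g : T2 -> \bar R) :
  measurable_fun setT g -> (forall y, 0 <= g y) ->
  \int[pushforward_measure]_y g y = \int[m]_x g (f x).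
Proof.
by move=> mg g0; rewrite -(preimage_setT f) -ge0_integral_pushforward.
Qed.

End pushforward_measure.

(** * Lebesgue measure on tuples *)

Section lebesgue_scaling.
Context {R : realType}.
Local Notation leb := (@lebesgue_measure R).

(** By uniqueness of Lebesgue measure: [s] times its image under multiplication by [s] gives each
    half-open interval its length. *)
Lemma lebesgue_measure_scale (s : R) (A : set (measurableTypeR R)) :
  (0 < s)%R -> measurable A ->
  leb ((fun x : measurableTypeR R => (s * x)%R : measurableTypeR R) @^-1` A) =
  (s^-1)%:E * leb A.
Proof.
move=> s0 mA.
have ms : measurable_fun setT
  (fun x : measurableTypeR R => (s * x)%R : measurableTypeR R).
  exact: measurable_funM.
have s0' : (0 <= s)%R by exact: ltW.
pose m : {measure set (measurableTypeR R) -> \bar R} :=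
  mscale (NngNum s0') (pushforward_measure leb ms).
have -> : leb A = m A.
  apply: lebesgue_measure_unique => // _ [[a b] _ <-].
  rewrite /m/= /mscale/= /pushforward.
  rewrite (_ : _ @^-1` _ = `](s^-1 * a)%R, (s^-1 * b)%R]%classic); last first.
    apply/seteqP; split => x /=; rewrite !in_itv/=.
      by rewrite -ltr_pdivrMl// -ler_pdivlMl.
    by rewrite ltr_pdivrMl// ler_pdivlMl.
  rewrite !lebesgue_measure_itv/= !lte_fin ltr_pM2l ?invr_gt0//.
  case: ifPn => _; last by rewrite mule0.
  by rewrite -!EFinB -EFinM -mulrBr mulrA divff ?mul1r// gt_eqF.
rewrite /m/= /mscale/= /pushforward muleA -EFinM mulVf ?mul1e//.
by rewrite gt_eqF.
Qed.

Lemma ge0_integral_lebesgue_scale (s : R) (f : measurableTypeR R -> \bar R) :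
  (0 < s)%R -> measurable_fun setT f -> (forall x, 0 <= f x) ->
  \int[leb]_x f (s * x)%R = (s^-1)%:E * \int[leb]_x f x.
Proof.
move=> s0 mf f0.
have ms : measurable_fun setT
  (fun x : measurableTypeR R => (s * x)%R : measurableTypeR R).
  exact: measurable_funM.
have s0' : (0 <= s^-1)%R by rewrite invr_ge0 ltW.
rewrite -(ge0_integral_pushforward_measure _ ms)//.
have := ge0_integral_mscale leb measurableT (NngNum s0') mf.
move=> <-//; apply: eq_measure_integral => A mA _.
by rewrite [LHS]lebesgue_measure_scale.
Qed.

End lebesgue_scaling.

Section lebesgue_tuple_measure.
Context {R : realType}.
Local Notation leb := (@lebesgue_measure R).

(** [lebesgue_tuple] is a recursion on bare set functions, while each product is a measure only once
    its second factor is known to be sigma-finite. The induction therefore carries the whole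
    structure in an existential, from which the instances below are drawn. *)
Lemma lebesgue_tuple_sigma_finite_measure n :
  exists mu : {sigma_finite_measure set (n.-tuple R) -> \bar R},
    @lebesgue_tuple R n = mu.
Proof.
elim: n => [|n [mu IH]].
  by exists (\d_[tuple])%E.
pose c (p : measurableTypeR R * n.-tuple R) : n.+1.-tuple R :=
  [tuple of p.1 :: p.2].
have mc : measurable_fun setT c.
  exact: (@measurable_cons _ _ _ (R : measurableType _) fst n snd).
pose lc := pushforward_measure (leb \x mu) mc.
have lcE : @lebesgue_tuple R n.+1 = lc by rewrite /= IH.
have lcs : sigma_finite setT lc.
  have /sigma_finiteP[G [TG ndG Goo]] := sigma_finiteT leb.
  have /sigma_finiteP[H [TH ndH Hoo]] := sigma_finiteT mu.
  pose F k := G k `*` H k.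
  have TF : [set: measurableTypeR R * n.-tuple R] = \bigcup_k F k.
    apply/seteqP; split => // -[x t] _.
    have [i _ Gx] : (\bigcup_k G k) x by rewrite -TG.
    have [j _ Ht] : (\bigcup_k H k) t by rewrite -TH.
    exists (maxn i j) => //; split => /=.
      by move: x Gx; exact/subsetPset/ndG/leq_maxl.
    by move: t Ht; exact/subsetPset/ndH/leq_maxr.
  have Foo k : measurable (F k) /\ (leb \x mu) (F k) < +oo.
    have [? ?] := Goo k; have [? ?] := Hoo k.
    split; first exact: measurableX.
    by rewrite product_measure1E// lte_mul_pinfty// ge0_fin_numE.
  (* The measurable inverse of [c]: it carries the exhausting rectangles [F k] over to sets of
     tuples of the same measure. *)
  pose u (t : n.+1.-tuple R) : measurableTypeR R * n.-tuple R :=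
    (thead t, [tuple of behead t]).
  have uc p : u (c p) = p.
    by apply: injective_projections => /=; [rewrite theadE|exact/val_inj].
  have mu_ : measurable_fun setT u.
    apply/measurable_fun_pairP; split.
      exact: (@measurable_tnth _ _ n.+1 ord0).
    exact: measurable_behead.
  exists (fun k => u @^-1` F k).
    by rewrite -preimage_bigcup -TF preimage_setT.
  move=> k; split.
    by rewrite -[X in measurable X]setTI; apply: mu_ => //; exact: (Foo k).1.
  rewrite /lc pushforward_measureE (_ : _ @^-1` _ = F k);
    first exact: (Foo k).2.
  by apply/seteqP; split => p /=; rewrite uc.
pose lcp : {sigma_finite_measure set _ -> \bar R} :=
  HB.pack (Measure.sort lc)
    (Measure_isSigmaFinite.Build _ _ _ (Measure.sort lc) lcs).
by exists lcp.
Qed.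

Section instance.
Variable n : nat.
Local Notation V := (@lebesgue_tuple R n).

Let V0 : V set0 = 0.
Proof. by have [mu ->] := lebesgue_tuple_sigma_finite_measure n. Qed.

Let V_ge0 A : 0 <= V A.
Proof. by have [mu ->] := lebesgue_tuple_sigma_finite_measure n. Qed.

Let V_sigma_additive : semi_sigma_additive V.
Proof.
have [mu ->] := lebesgue_tuple_sigma_finite_measure n.
exact: measure_semi_sigma_additive.
Qed.

HB.instance Definition _ := isMeasure.Build _ _ _ V V0 V_ge0 V_sigma_additive.

Let V_sigma_finite : sigma_finite setT V.
Proof.
have [mu ->] := lebesgue_tuple_sigma_finite_measure n.
exact: sigma_finiteT.
Qed.

HB.instance Definition _ := Measure_isSigmaFinite.Build _ _ _ V V_sigma_finite.

End instance.

Definition scale_tuple n (s : R) (x : n.-tuple R) : n.-tuple R :=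
  [tuple (s * tnth x i)%R | i < n].

Lemma tnth_scale_tuple n (s : R) (x : n.-tuple R) i :
  tnth (scale_tuple s x) i = (s * tnth x i)%R.
Proof. exact: tnth_mktuple. Qed.

Lemma scale_tuple_cons n (s x : R) (t : n.-tuple R) :
  scale_tuple s [tuple of x :: t] = [tuple of (s * x)%R :: scale_tuple s t].
Proof.
apply: eq_from_tnth => i; rewrite tnth_scale_tuple.
case: (unliftP ord0 i) => [j ->|->]; last by rewrite !tnth0.
by rewrite !tnthS tnth_scale_tuple.
Qed.

Lemma measurable_scale_tuple d (T : measurableType d) n (s : T -> R)
    (x : T -> n.-tuple R) :
  measurable_fun setT s -> measurable_fun setT x ->
  measurable_fun setT (fun t => scale_tuple (s t) (x t)).
Proof.
move=> ms mx; apply/measurable_fun_tnthP => i.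
rewrite (_ : _ \o _ = fun t => (s t * tnth (x t) i)%R); last first.
  by apply/funext => t; rewrite /= tnth_scale_tuple.
apply: measurable_funM => //.
by apply: (measurableT_comp (measurable_tnth i)).
Qed.

(** Slicing at the first coordinate, the slices contribute [s ^- n] by induction and the outer
    integral one more [s^-1]. *)
Lemma lebesgue_tuple_scale n (s : R) (A : set (n.-tuple R)) :
  (0 < s)%R -> measurable A ->
  @lebesgue_tuple R n (scale_tuple s @^-1` A) =
  (s ^- n)%:E * @lebesgue_tuple R n A.
Proof.
move=> s0; elim: n A => [|n IH] A mA.
  rewrite expr0 invr1 mul1e /= !diracE; congr ((nat_of_bool _)%:R)%:E.
  by apply/idP/idP; rewrite !inE/= [scale_tuple _ _]tuple0.
pose S (B : set (n.+1.-tuple R)) (x : R) : set (n.-tuple R) :=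
  [set t : n.-tuple R | B [tuple of x :: t]].
have lebS (B : set (n.+1.-tuple R)) :
    @lebesgue_tuple R n.+1 B = \int[leb]_x @lebesgue_tuple R n (S B x).
  rewrite /= /pushforward; apply: eq_integral => x _ /=.
  by congr (lebesgue_tuple _); apply/seteqP; split => t;
    rewrite /xsection/= inE.
have mcons : measurable_fun setT
    (fun p : measurableTypeR R * n.-tuple R => [tuple of p.1 :: p.2]).
  exact: (@measurable_cons _ _ _ (R : measurableType _) fst n snd).
pose A' := (fun p : measurableTypeR R * n.-tuple R => [tuple of p.1 :: p.2])
  @^-1` A.
have mA' : measurable A' by rewrite -[X in measurable X]setTI; exact: mcons.
have SA x : S A x = xsection A' x.
  by apply/seteqP; split => t; rewrite /xsection/= inE.
have mAx x : measurable (S A x) by rewrite SA; exact: measurable_xsection.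
have mphi : measurable_fun setT (fun x : measurableTypeR R =>
    @lebesgue_tuple R n (S A x)).
  under eq_fun do rewrite SA.
  exact: measurable_fun_xsection.
rewrite !lebS.
transitivity (\int[leb]_x ((s ^- n)%:E * @lebesgue_tuple R n (S A (s * x)%R))).
  apply: eq_integral => x _; rewrite -IH//; congr (lebesgue_tuple _).
  by apply/seteqP; split => t /=; rewrite /S/= scale_tuple_cons.
have sn0 : (0 <= s ^- n)%R by rewrite invr_ge0 exprn_ge0// ltW.
rewrite ge0_integralZl//; last first.
  apply: (measurableT_comp mphi).
  exact: measurable_funM.
rewrite (ge0_integral_lebesgue_scale s0 mphi)// muleA -EFinM.
by rewrite -invfM exprS mulrC.
Qed.

Lemma ge0_integral_lebesgue_tuple_scale n (s : R) (f : n.-tuple R -> \bar R) :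
  (0 < s)%R -> measurable_fun setT f -> (forall x, 0 <= f x) ->
  \int[@lebesgue_tuple R n]_x f (scale_tuple s x) =
  (s ^- n)%:E * \int[@lebesgue_tuple R n]_x f x.
Proof.
move=> s0 mf f0.
have ms : measurable_fun setT (@scale_tuple n s)
  by exact: measurable_scale_tuple.
have s0' : (0 <= s ^- n)%R by rewrite invr_ge0 exprn_ge0// ltW.
rewrite -(ge0_integral_pushforward_measure _ ms)//.
have := ge0_integral_mscale (@lebesgue_tuple R n) measurableT (NngNum s0') mf.
move=> <-//; apply: eq_measure_integral => A mA _.
by rewrite [LHS]lebesgue_tuple_scale.
Qed.

End lebesgue_tuple_measure.

(** * An improper integral of a shifted power *)

Section powR_integral.
Context {R : realType}.
Local Notation leb := (@lebesgue_measure R).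

Lemma is_derive_powR_shift (sigma b x : R) : (sigma < x)%R ->
  is_derive x 1%R (fun s : R => ((s - sigma) `^ b)%R)
    (b * (x - sigma) `^ (b - 1))%R.
Proof.
move=> sx; have xs : (x - sigma)%R \in `]0%R, +oo[.
  by rewrite in_itv/= andbT subr_gt0.
have dp : is_derive (x - sigma)%R 1%R (@powR R ^~ b)
    (b * (x - sigma) `^ (b - 1))%R.
  apply: DeriveDef; first exact: derivable_powR.
  by rewrite -derive1E powR_derive1.
have ds : is_derive x 1%R (fun s : R => s - sigma)%R 1%R.
  by apply: is_derive_eq; rewrite oppr0 addr0.
have := @is_derive1_comp _ (@powR R ^~ b) (fun s => s - sigma)%R x _ _ dp ds.
by rewrite mulr1.
Qed.

(* The integrand may blow up at [sigma], hence the limit of integrals over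
   [sigma + u_n, 1]. *)
Lemma integral_powR_shift (a sigma : R) : (0 < a)%R -> (sigma <= 1)%R ->
  \int[leb]_(s in `]sigma, 1%R]) (a * (s - sigma) `^ (a - 1))%:E =
  ((1 - sigma) `^ a)%:E.
Proof.
move=> a0; rewrite le_eqVlt => /predU1P[->|s1].
  rewrite subrr powR0 ?gt_eqF//.
  by rewrite set_itvoc0 integral_set0.
(* [harmonic 0] is 1, so the shift to [n.+1] keeps [sigma + u n] strictly below 1 from [n = 0] on,
   as the fundamental theorem of calculus requires. *)
pose u n : R := ((1 - sigma) * harmonic n.+1)%R.
have u0 n : (0 < u n)%R by rewrite mulr_gt0// ?subr_gt0// invr_gt0.
have u1 n : (sigma + u n < 1)%R.
  rewrite -ltrBrDl /u gtr_pMr ?subr_gt0// invf_lt1// ltr1n//.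
have ucvg : u n @[n --> \oo] --> 0%R.
  rewrite -[X in _ --> X](mulr0 (1 - sigma)%R); apply: cvgMr.
  by rewrite (cvg_shiftS (@harmonic R)); exact: cvg_harmonic.
pose f s : \bar R := (a * (s - sigma) `^ (a - 1))%:E.
pose F n := `[(sigma + u n)%R, 1%R]%classic.
have FE n x : F n x = ((sigma + u n <= x)%R && (x <= 1)%R) :> Prop.
  by rewrite /F/= in_itv.
have Fcup : \bigcup_n F n = `]sigma, 1%R]%classic.
  apply/seteqP; split => [x [n _]|x] /=; rewrite in_itv/= ?FE.
    by move=> /andP[h ->]; rewrite andbT (lt_le_trans _ h)// ltrDl.
  move=> /andP[sx x1].
  have : \forall n \near \oo, (u n < x - sigma)%R.
    by apply: (cvgr_lt _ ucvg); rewrite subr_gt0.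
  move=> [N _ /(_ N (leqnn _)) /= uN]; exists N => //.
  by rewrite FE x1 andbT -lerBrDl ltW.
have mf : measurable_fun setT f.
  apply/measurable_EFinP; apply: measurable_funM => //.
  apply: (measurableT_comp (measurable_powR _)).
  exact: measurable_funB.
have intF n : \int[leb]_(s in F n) f s = ((1 - sigma) `^ a - u n `^ a)%:E.
  have lts x : (sigma + u n <= x)%R -> (sigma < x)%R.
    by apply: lt_le_trans; rewrite ltrDl.
  rewrite (@continuous_FTC2 _ (fun s => a * (s - sigma) `^ (a - 1))%R
    (fun s => (s - sigma) `^ a)%R _ _ (u1 n)).
  - by rewrite -EFinB addrAC subrr add0r.
  - apply: derivable_within_continuous => x;
    rewrite in_itv/= => /andP[/lts h _].
    have [? _] := is_derive_powR_shift (a - 1) h.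
    exact: derivableM.
  - have dv x : (sigma + u n <= x)%R ->
        {for x, continuous (fun s => (s - sigma) `^ a)%R}.
      move=> /lts h; have [? _] := is_derive_powR_shift a h.
      by apply: differentiable_continuous; apply/derivable1_diffP.
    split.
    + move=> x; rewrite in_itv/= => /andP[/ltW/lts h _].
      by have [] := is_derive_powR_shift a h.
    + by apply: cvg_at_right_filter; apply: dv.
    + by apply: cvg_at_left_filter; apply: dv; rewrite ltW.
  - move=> x; rewrite in_itv/= => /andP[/ltW/lts h _].
    have [_] := is_derive_powR_shift a h.
    by rewrite derive1E.
rewrite -Fcup; apply: (@cvg_unique _ _ (\int[leb]_(s in F n) f s @[n --> \oo]))
  => //.
  apply: ge0_nondecreasing_set_cvg_integral => //.
  - apply/nondecreasing_seqP => n; apply/subsetPset => x; rewrite !FE.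
    move=> /andP[h ->]; rewrite andbT (le_trans _ h)// lerD2l.
    rewrite /u ler_pM2l ?subr_gt0//= lef_pV2 ?posrE// ler_nat//.
  - by move=> n; exact: measurable_itv.
  - by move=> n; exact: measurable_funTS.
  - by move=> n x _; rewrite lee_fin mulr_ge0// ?powR_ge0// ltW.
rewrite /= (_ : (fun n => _) = fun n => ((1 - sigma) `^ a - u n `^ a)%:E);
  last first.
  exact/funext.
apply/fine_cvgP; split; first exact: nearW.
rewrite -[X in _ --> X](subr0 ((1 - sigma) `^ a)%R); apply: cvgB.
  exact: cvg_cst.
have /cvg_at_rightP := @powR_cvg0 R a a0.
exact.
Qed.

End powR_integral.

(** * Size-biasing of Dirichlet distributions *)

Section dirichlet_size_bias.
Context {R : realType}.
Local Notation leb := (@lebesgue_measure R).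

Definition mix n (j : 'I_n) (s : R) (p : n.-tuple R) : n.-tuple R :=
  [tuple (s * tnth p i + (1 - s) * (i == j)%:R)%R | i < n].

Lemma Gamma_ge0 (a : R) : (0 <= Gamma a)%R.
Proof.
rewrite fine_ge0//; apply: integral_ge0 => x _.
by rewrite lee_fin mulr_ge0 ?powR_ge0 ?expR_ge0.
Qed.

Lemma dirichlet_density_ge0 n (a p : n.-tuple R) :
  (0 <= dirichlet_density a p)%R.
Proof.
rewrite mulr_ge0// ?divr_ge0 ?Gamma_ge0//; apply: prodr_ge0 => i _.
  exact: Gamma_ge0.
exact: powR_ge0.
Qed.

Lemma tnth_simplex_point m (x : m.-tuple R) (i : 'I_m) :
  tnth (simplex_point x) (widen_ord (leqnSn m) i) = tnth x i.
Proof. by rewrite !(tnth_nth 0%R)/= nth_rcons size_tuple ltn_ord. Qed.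

Lemma tnth_simplex_point_max m (x : m.-tuple R) :
  tnth (simplex_point x) ord_max = (1 - \sum_(i < m) tnth x i)%R.
Proof. by rewrite (tnth_nth 0%R)/= nth_rcons size_tuple ltnn eqxx. Qed.

Lemma ord_recrP m (i : 'I_m.+1) :
  i = ord_max \/ exists j : 'I_m, i = widen_ord (leqnSn m) j.
Proof.
case: (unliftP ord_max i) => [j ->|->]; [right|by left].
by exists j; apply/val_inj; rewrite /= /bump leqNgt ltn_ord.
Qed.

Lemma measurable_sum_tnth m :
  measurable_fun setT (fun x : m.-tuple R => (\sum_(i < m) tnth x i)%R).
Proof. by apply: measurable_sum => i; exact: measurable_tnth. Qed.

Lemma measurable_simplex_point m : measurable_fun setT (@simplex_point R m).
Proof.
apply/measurable_fun_tnthP => i.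
have [->|[j ->]] := ord_recrP i.
  under [X in measurable_fun _ X]eq_fun do rewrite /= tnth_simplex_point_max.
  by apply: measurable_funB => //; exact: measurable_sum_tnth.
under [X in measurable_fun _ X]eq_fun do rewrite /= tnth_simplex_point.
exact: measurable_tnth.
Qed.

Lemma simplex_pointP m (x : m.-tuple R) : simplex (simplex_point x) <->
  (forall i, (0 <= tnth x i)%R) /\ (\sum_(i < m) tnth x i <= 1)%R.
Proof.
split => [[x01 _]|[x0 x1]].
  split=> [i|]; first by have /andP[] := x01 (widen_ord (leqnSn m) i);
    rewrite tnth_simplex_point.
  by have /andP[+ _] := x01 ord_max; rewrite tnth_simplex_point_max subr_ge0.
split=> [i|].
  have [->|[j ->]] := ord_recrP i.
    rewrite tnth_simplex_point_max subr_ge0 x1/= gerBl.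
    exact: sumr_ge0.
  rewrite tnth_simplex_point x0/= (le_trans _ x1)// (bigD1 j)//= lerDl.
  exact: sumr_ge0.
rewrite big_ord_recr/= tnth_simplex_point_max.
under eq_bigr do rewrite tnth_simplex_point.
by rewrite addrC subrK.
Qed.

Lemma measurable_simplex_domain m :
  measurable [set x : m.-tuple R | simplex (simplex_point x)].
Proof.
rewrite (_ : mkset _ =
    (\bigcap_(i in [set: 'I_m]) ((@tnth _ R ^~ i) @^-1` `[0%R, +oo[)) `&`
    ((fun x : m.-tuple R => \sum_(i < m) tnth x i)%R @^-1` `]-oo, 1%R])).
  apply: measurableI.
    apply: fin_bigcap_measurable => // i _; rewrite -[X in measurable X]setTI.
    exact: measurable_tnth.
  rewrite -[X in measurable X]setTI; exact: measurable_sum_tnth.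
apply/seteqP; split => x.
  move=> /simplex_pointP[x0 x1]; split => [i _|]/=; rewrite in_itv/=//.
  by rewrite x0.
move=> [x0 x1]; apply/simplex_pointP; split => [i|].
  by have := x0 i Logic.I; rewrite /= in_itv/= andbT.
by move: x1; rewrite /= in_itv.
Qed.

Lemma measurable_dirichlet_density m (a : m.+1.-tuple R) :
  measurable_fun setT (fun x => dirichlet_density a (@simplex_point R m x)).
Proof.
apply: measurable_funM => //; apply: measurable_prod => i _.
apply: (measurableT_comp (measurable_powR _)).
exact: (measurableT_comp (measurable_tnth i) (@measurable_simplex_point m)).
Qed.

(** In the chart given by the first [m] coordinates the last vertex is the origin, so moving towards
    it is plain scaling. This is what singles out the last index. *)
Lemma mix_simplex_point m (s : R) (x : m.-tuple R) :
  mix ord_max s (simplex_point x) = simplex_point (scale_tuple s x).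
Proof.
apply: eq_from_tnth => i; rewrite tnth_mktuple.
have [->|[j ->]] := ord_recrP i.
  rewrite !tnth_simplex_point_max eqxx mulr1 mulrBr mulr1.
  under [in RHS]eq_bigr do rewrite tnth_scale_tuple.
  by rewrite -mulr_sumr addrC addrA subrK.
rewrite !tnth_simplex_point tnth_scale_tuple -val_eqE/= ltn_eqF//.
by rewrite mulr0 addr0.
Qed.

Lemma prod_powR (s : R) (I : finType) (c : I -> R) : (0 < s)%R ->
  (\prod_i s `^ c i = s `^ (\sum_i c i))%R.
Proof.
move=> s0; elim/big_rec2: _ => [|i x y _ ->]; first by rewrite powRr0.
by rewrite powRD ?(gt_eqF s0) ?implybT.
Qed.

Section core.
Variables (m : nat) (a : m.+1.-tuple R).
Hypothesis a0 : forall i, (0 < tnth a i)%R.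
Local Notation V := (@lebesgue_tuple R m).
Local Notation theta := (\sum_(i < m.+1) tnth a i)%R.
Local Notation alpha := (tnth a ord_max).

Let S := [set x : m.-tuple R | simplex (simplex_point x)].
(** The density extended by zero to all of the chart, so that scaling can be applied on the whole
    space and the domain is tracked by the indicator. *)
Let g (x : m.-tuple R) : R :=
  (dirichlet_density a (simplex_point x) * \1_S x)%R.

Let g0 x : (0 <= g x)%R.
Proof. by rewrite mulr_ge0// dirichlet_density_ge0. Qed.

Let mg : measurable_fun setT g.
Proof.
apply: measurable_funM; first exact: measurable_dirichlet_density.
by apply: measurable_indic; exact: measurable_simplex_domain.
Qed.

Definition dirichlet_measure : {measure set m.+1.-tuple R -> \bar R} :=
  pushforward_measure (density_measure V g0 mg) (@measurable_simplex_point m).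

Lemma dirichlet_measureE A : dirichlet_measure A =
  \int[V]_(x in [set x | (@simplex R m.+1 `&` A) (simplex_point x)])
    (dirichlet_density a (simplex_point x))%:E.
Proof.
rewrite /dirichlet_measure pushforward_measureE /density_measure/= /mdensity.
rewrite (_ : [set x | _] = @simplex_point R m @^-1` A `&` S); last first.
  by apply/seteqP; split => x [].
rewrite [RHS]integral_mkcondr; apply: eq_integral => x _.
by rewrite epatch_indic EFinM.
Qed.

Let c : R := (Gamma theta / \prod_(i < m.+1) Gamma (tnth a i))%R.
Let k (y : m.-tuple R) : R :=
  (c * \prod_(i < m) tnth y i `^ (tnth a (widen_ord (leqnSn m) i) - 1))%R.

Let gE (y : m.-tuple R) :
  g y = (k y * (1 - \sum_(i < m) tnth y i) `^ (alpha - 1) * \1_S y)%R.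
Proof.
congr (_ * _)%R; rewrite /k /dirichlet_density -[RHS]mulrA; congr (_ * _)%R.
rewrite big_ord_recr/= tnth_simplex_point_max; congr (_ * _)%R.
by under eq_bigr do rewrite tnth_simplex_point.
Qed.

Let sum_scale (y : m.-tuple R) (s : R) :
  (\sum_(i < m) tnth (scale_tuple s y) i = s * \sum_(i < m) tnth y i)%R.
Proof. by under eq_bigr do rewrite tnth_scale_tuple; rewrite mulr_sumr. Qed.

(* The powers of [s] cancel: the exponents are [theta - 1], [- m],
   [1 - a_i] for each of the first [m] parameters and [1 - alpha]. *)
Let g_scale (y : m.-tuple R) (s : R) : (0 < s)%R ->
  (forall i, (0 <= tnth y i)%R) -> (\sum_(i < m) tnth y i <= s)%R ->
  (s `^ (theta - 1) * s ^- m * g (scale_tuple s^-1 y) =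
   k y * (s - \sum_(i < m) tnth y i) `^ (alpha - 1))%R.
Proof.
move=> s0 y0 ys; rewrite gE sum_scale indicE mem_set; last first.
  apply/simplex_pointP; split => [i|].
    by rewrite tnth_scale_tuple mulr_ge0// invr_ge0 ltW.
  by rewrite sum_scale ler_pdivrMl// mulr1.
rewrite mulr1.
have sV b : (s^-1 `^ b = s `^ (- b))%R.
  by rewrite -powR_inv1 ?ltW// -powRrM mulN1r.
have kE : k (scale_tuple s^-1 y) = (k y *
    s `^ (\sum_(i < m) - (tnth a (widen_ord (leqnSn m) i) - 1)))%R.
  rewrite /k -mulrA; congr (_ * _)%R; rewrite -prod_powR// -big_split/=.
  apply: eq_bigr => i _.
  by rewrite tnth_scale_tuple powRM ?invr_ge0 ?(ltW s0)// sV mulrC.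
rewrite kE (_ : 1 - s^-1 * _ = s^-1 * (s - \sum_(i < m) tnth y i))%R;
  last first.
  by rewrite mulrBr mulVf ?gt_eqF.
rewrite powRM ?invr_ge0 ?subr_ge0 ?(ltW s0)// sV.
set q := (_ `^ (alpha - 1))%R.
rewrite -powR_invn ?ltW//.
set e1 := (theta - 1)%R; set e2 := (- m%:R)%R.
set e3 := (\sum_(i < m) - _)%R; set e4 := (- _)%R.
have e0 : (e1 + e2 + e3 + e4 = 0)%R.
  rewrite /e1 /e2 /e3 /e4 big_ord_recr/= sumrN sumrB sumr_const card_ord.
  by ring.
have sn0 : (s != 0)%R by rewrite gt_eqF.
have : (s `^ e1 * s `^ e2 * s `^ e3 * s `^ e4 = 1)%R.
  by rewrite -!powRD ?sn0 ?implybT// e0 powRr0.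
by move=> h; rewrite -[RHS]mul1r -h; ring.
Qed.

Let g_scale0 (y : m.-tuple R) (s : R) : (0 < s)%R ->
  ~ ((forall i, (0 <= tnth y i)%R) /\ (\sum_(i < m) tnth y i <= s)%R) ->
  g (scale_tuple s^-1 y) = 0%R.
Proof.
move=> s0 h; rewrite gE indicE memNset ?mulr0// => /simplex_pointP[y0 y1].
apply: h; split => [i|].
  by have := y0 i; rewrite tnth_scale_tuple pmulr_rge0// invr_gt0.
by move: y1; rewrite sum_scale ler_pdivrMl// mulr1.
Qed.

Let c0 : (0 <= c)%R.
Proof.
by rewrite divr_ge0 ?Gamma_ge0//; apply: prodr_ge0 => i _; exact: Gamma_ge0.
Qed.

Let k0 y : (0 <= k y)%R.
Proof.
by rewrite mulr_ge0//; apply: prodr_ge0 => i _; exact: powR_ge0.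
Qed.

(** If [y] has a negative coordinate or [sigma > 1], both sides vanish. Otherwise only the
    [s >= sigma] contribute, and there [g_scale] leaves the integral of a shifted power. The
    absolute value keeps the weight nonnegative off the simplex, where [g y] is zero. *)
Let integral_scale (y : m.-tuple R) :
  \int[leb]_(s in `]0%R, 1%R])
    (alpha * (s `^ (theta - 1) * s ^- m * g (scale_tuple s^-1 y)))%:E =
  (`|1 - \sum_(i < m) tnth y i| * g y)%:E.
Proof.
set sigma := (\sum_(i < m) tnth y i)%R.
have [y0|ny0] := pselect (forall i, (0 <= tnth y i)%R); last first.
  rewrite integral0_eq; last first.
    move=> s /=; rewrite in_itv/= => /andP[s0 _].
    by rewrite g_scale0 ?mulr0// => -[].
  by rewrite gE indicE memNset ?mulr0// => /simplex_pointP[].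
have sigma0 : (0 <= sigma)%R by exact: sumr_ge0.
have [s1|s1] := leP sigma 1%R; last first.
  rewrite integral0_eq; last first.
    move=> s /=; rewrite in_itv/= => /andP[s0 s1'].
    rewrite g_scale0 ?mulr0// => -[_ /le_trans/(_ s1')].
    by rewrite leNgt s1.
  rewrite gE indicE memNset ?mulr0// => /simplex_pointP[_].
  by rewrite leNgt s1.
transitivity (\int[leb]_(s in `]sigma, 1%R])
    ((k y)%:E * (alpha * (s - sigma) `^ (alpha - 1))%:E)).
  have mF : measurable_fun setT (fun s : R =>
    ((k y)%:E * (alpha * (s - sigma) `^ (alpha - 1))%:E)).
    apply/measurable_EFinP; apply: measurable_funM => //.
    apply: measurable_funM => //; apply: (measurableT_comp (measurable_powR _)).
    exact: measurable_funB.
  (* The values of [s] for which the rescaled point lies in the closed simplex. This set contains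
     the endpoint [sigma], which has measure zero, exactly when [sigma > 0]. *)
  pose E := [set s : R | (0 < s <= 1)%R /\ (sigma <= s)%R].
  rewrite (_ : \int[leb]_(s in `]sigma, 1%R]) _ = \int[leb]_(s in E)
      ((k y)%:E * (alpha * (s - sigma) `^ (alpha - 1))%:E)); last first.
    have [sp|] := ltP 0%R sigma.
      rewrite integral_itv_obnd_cbnd; last exact: measurable_funTS.
      rewrite (_ : E = `[sigma, 1%R]%classic)//.
      apply/seteqP; split => s /=; rewrite in_itv/=.
        by move=> [/andP[_ ->] ->].
      by move=> /andP[ss s1']; split; rewrite ?s1' ?andbT// (lt_le_trans sp ss).
    move=> sn; have sz : sigma = 0%R by apply/eqP; rewrite eq_le sn.
    rewrite (_ : E = `]sigma, 1%R]%classic)//.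
    apply/seteqP; split => s /=; rewrite in_itv/= sz.
      by move=> [/andP[-> ->]].
    by move=> /andP[s0 s1']; split; rewrite ?s0 ?s1'// sz ltW.
  rewrite (_ : E = `]0%R, 1%R]%classic `&` `[sigma, +oo[); last first.
    by apply/seteqP; split => s /=; rewrite !in_itv/= andbT.
  rewrite [RHS]integral_mkcondr; apply: eq_integral => s.
  rewrite inE/= in_itv/= => /andP[sp s1'].
  rewrite /patch; case: ifPn => [/set_mem|/negP ss].
    rewrite /= in_itv/= andbT => ss.
    by rewrite g_scale// -EFinM; congr EFin; ring.
  rewrite g_scale0 ?mulr0// => -[_ ss'].
  by apply: ss; apply/mem_set; rewrite /= in_itv/= andbT.
rewrite ge0_integralZl//; last 3 first.
- apply: measurable_funTS; apply/measurable_EFinP.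
  apply: measurable_funM => //; apply: (measurableT_comp (measurable_powR _)).
  exact: measurable_funB.
- by move=> s _; rewrite lee_fin mulr_ge0 ?powR_ge0// ltW.
- by rewrite lee_fin.
rewrite integral_powR_shift// -EFinM; congr EFin.
rewrite gE indicE mem_set ?mulr1; last exact/simplex_pointP.
(* One factor [1 - sigma] splits off the power with exponent [alpha]; since [alpha > 0] this holds
   even for [sigma = 1]. *)
rewrite ger0_norm ?subr_ge0// -/sigma -[in LHS](mulr_powRB1 _ (a0 ord_max)).
  by ring.
by rewrite subr_ge0.
Qed.

(** Inverses become real powers, which are measurable in [s] on the whole line; both forms agree for
    [s >= 0]. The joint integrand in the next proof needs this form. *)
Let integral_scale_powR (y : m.-tuple R) :
  \int[leb]_(s in `]0%R, 1%R]) (alpha * (s `^ (theta - 1) * s `^ (- m%:R) *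
      g (scale_tuple (s `^ (-1)) y)))%:E =
  (`|1 - \sum_(i < m) tnth y i| * g y)%:E.
Proof.
rewrite -integral_scale; apply: eq_integral => s.
rewrite inE/= in_itv/= => /andP[/ltW s0 _].
by rewrite powR_inv1// powR_invn.
Qed.

(* Scaling the first [m] coordinates by [s] and integrating over [s] first. *)
Lemma dirichlet_measure_size_bias (A : set (m.+1.-tuple R)) : measurable A ->
  \int[dirichlet_measure]_(p in A) (`|tnth p ord_max|)%:E =
  \int[leb]_(s in `]0%R, 1%R])
    ((alpha * s `^ (theta - 1))%:E * dirichlet_measure (mix ord_max s @^-1` A)).
Proof.
move=> mA; pose sp := @simplex_point R m.
have msp : measurable_fun setT sp by exact: measurable_simplex_point.
have mspA : measurable (sp @^-1` A) by rewrite -[X in measurable X]setTI;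
  exact: msp.
(* The joint integrand in [s] and [y], with both domains of integration turned into indicators so
   that Tonelli applies on the full product. *)
pose F (z : R * m.-tuple R) : R :=
  (alpha * (z.1 `^ (theta - 1) * z.1 `^ (- m%:R) *
            g (scale_tuple (z.1 `^ (-1)) z.2)) *
   \1_(sp @^-1` A) z.2 * \1_(`]0%R, 1%R]) z.1)%R.
have mF : measurable_fun setT F.
  apply: measurable_funM; last first.
    by apply: (measurableT_comp _ measurable_fst); exact: measurable_indic.
  apply: measurable_funM; last first.
    by apply: (measurableT_comp _ measurable_snd); exact: measurable_indic.
  apply: measurable_funM => //; apply: measurable_funM.
    apply: measurable_funM;
      exact: (measurableT_comp (measurable_powR _) measurable_fst).
  apply: (measurableT_comp mg); apply: measurable_scale_tuple => //.
  exact: (measurableT_comp (measurable_powR _) measurable_fst).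
have F0 z : (0 <= F z)%R.
  rewrite /F mulr_ge0// mulr_ge0// mulr_ge0 ?(ltW (a0 _))//.
  by rewrite mulr_ge0// mulr_ge0 ?powR_ge0.
have mG y : measurable_fun setT (fun s : R => (alpha * (s `^ (theta - 1) *
    s `^ (- m%:R) * g (scale_tuple (s `^ (-1)) y)))%R).
  apply: measurable_funM => //; apply: measurable_funM.
    by apply: measurable_funM; exact: measurable_powR.
  by apply: (measurableT_comp mg); exact: measurable_scale_tuple.
have mabs : measurable_fun setT (fun p : m.+1.-tuple R => (`|tnth p
  ord_max|)%:E).
  apply/measurable_EFinP.
  exact: (measurableT_comp (@normr_measurable _ _) (measurable_tnth _)).
have mabsA : measurable_fun setT
    ((fun p : m.+1.-tuple R => (`|tnth p ord_max|)%:E) \_ A).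
  by apply/(measurable_restrictT _ mA); exact: measurable_funTS.
(* For fixed [y], integrating out [s] produces the weight [|p_max|] times the density. *)
transitivity (\int[V]_y \int[leb]_s (F (s, y))%:E).
  rewrite integral_mkcond /dirichlet_measure.
  rewrite (ge0_integral_pushforward_measure _ (@measurable_simplex_point m))//.
    rewrite ge0_integral_density_measure//.
    + apply: eq_integral => y _.
      transitivity (\int[leb]_(s in `]0%R, 1%R]) ((\1_(sp @^-1` A) y)%:E *
       (alpha * (s `^ (theta - 1) * s `^ (- m%:R) *
                 g (scale_tuple (s `^ (-1)) y)))%:E)).
        rewrite ge0_integralZl//; last 2 first.
        * apply: measurable_funTS; apply/measurable_EFinP; exact: mG.
        * move=> s _; rewrite lee_fin mulr_ge0 ?(ltW (a0 _))//.
          by rewrite mulr_ge0// mulr_ge0 ?powR_ge0.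
        rewrite integral_scale_powR epatch_indic tnth_simplex_point_max.
        by rewrite -!EFinM; congr EFin; rewrite mulrAC mulrC.
      rewrite integral_mkcond; apply: eq_integral => s _.
      by rewrite epatch_indic /F/= -!EFinM; congr EFin; ring.
    + by move=> y; apply: erestrict_ge0 => p _; rewrite lee_fin.
    + by apply: (measurableT_comp mabsA).
  by move=> y; apply: erestrict_ge0 => p _; rewrite lee_fin.
have := @fubini_tonelli _ _ (measurableTypeR R) _ R leb V (fun z => (F z)%:E).
move=> <-; last 2 first.
- exact/measurable_EFinP.
- by move=> z; rewrite lee_fin.
rewrite [RHS]integral_mkcond; apply: eq_integral => s _.
rewrite /patch; case: ifPn => [|sn]; last first.
  rewrite integral0_eq// => y _.
  by rewrite /F/= [X in (_ * X)%R]indicE (negbTE sn) mulr0.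
move=> /[dup] sI; rewrite inE/= in_itv/= => /andP[s0 s1].
pose h (y : m.-tuple R) := (\1_(sp @^-1` A) y * g (scale_tuple s^-1 y))%R.
have h0 y : (0 <= h y)%R by rewrite mulr_ge0.
have mh : measurable_fun setT h.
  apply: measurable_funM; first exact: measurable_indic.
  by apply: (measurableT_comp mg); exact: measurable_scale_tuple.
transitivity (\int[V]_y ((alpha * s `^ (theta - 1) * s ^- m)%:E * (h y)%:E)).
  apply: eq_integral => y _; rewrite -EFinM; congr EFin.
  rewrite /F/= [\1_(`]0%R, 1%R]) s]indicE sI /h.
  by rewrite powR_inv1 ?(ltW s0)// powR_invn ?(ltW s0)// mulr1; ring.
rewrite ge0_integralZl//; last 3 first.
- exact/measurable_EFinP.
- by move=> y _; rewrite lee_fin.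
- rewrite lee_fin mulr_ge0//; last by rewrite invr_ge0 exprn_ge0// ltW.
  by rewrite mulr_ge0 ?powR_ge0 ?(ltW (a0 _)).
rewrite EFinM -muleA; congr (_ * _).
(* The change of variables from [y] to [scale_tuple s y] absorbs [s ^- m]: the density is then taken
   at [y] itself, and the point tested against [A] becomes the mixture. *)
rewrite -(@ge0_integral_lebesgue_tuple_scale _ _ s (fun y => (h y)%:E))//;
  last first.
  exact/measurable_EFinP.
rewrite /dirichlet_measure (pushforward_measureE _ msp) /density_measure/=
  /mdensity.
rewrite [RHS]integral_mkcond; apply: eq_integral => y _.
rewrite epatch_indic -EFinM mulrC; congr EFin; rewrite /h; congr (_ * _)%R.
  by rewrite !indicE; congr ((nat_of_bool _)%:R)%R; apply/idP/idP;
    rewrite !inE/= mix_simplex_point.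
congr g; apply: eq_from_tnth => i.
by rewrite !tnth_scale_tuple mulKf// gt_eqF.
Qed.

End core.
End dirichlet_size_bias.

(** * One parameter and vanishing parameters *)

Section dirichlet_size_bias_general.
Context {R : realType}.
Local Notation leb := (@lebesgue_measure R).

(* [j] is the last index; this form avoids casts between equal sizes. *)
Lemma dirichlet_pos_size_bias k (a : k.-tuple R) :
  (0 < k)%N -> (forall i, (0 < tnth a i)%R) ->
  exists nu : {measure set k.-tuple R -> \bar R},
    (forall A, dirichlet_pos a A = nu A) /\
    (forall j : 'I_k, j.+1 = k -> forall A, measurable A ->
      \int[nu]_(p in A) (`|tnth p j|)%:E =
      \int[leb]_(s in `]0%R, 1%R])
        ((tnth a j * s `^ (\sum_(i < k) tnth a i - 1))%:E *
         nu (mix j s @^-1` A))).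
Proof.
case: k a => [//|[|m]] a _ a0.
  exists (\d_([tuple 1%R] : 1.-tuple R)); split => // j jk A mA.
  have mE s : mix j s [tuple 1%R] = [tuple 1%R] :> 1.-tuple R.
    apply: eq_from_tnth => i; rewrite tnth_mktuple !ord1 !(tnth_nth 0%R)/=.
    by rewrite ?eqxx !mulr1 addrC subrK.
  rewrite integral_dirac//; last first.
    apply: measurable_funTS; apply/measurable_EFinP.
    exact: (measurableT_comp (@normr_measurable _ _) (measurable_tnth _)).
  rewrite (ord1 j) (tnth_nth 0%R)/= normr1 mule1.
  (* With one parameter the law is a Dirac mass at a point fixed by [mix], and what remains is that
     [tnth a 0 * s ^ (tnth a 0 - 1)] integrates to 1. The term [s - 0] matches [integral_powR_shift]
     at [sigma = 0]. *)
  transitivity (\int[leb]_(s in `]0%R, 1%R])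
     (\d_([tuple 1%R] : 1.-tuple R) A *
      (tnth a 0%R * (s - 0) `^ (tnth a 0%R - 1))%:E)); last first.
    apply: eq_integral => s _; rewrite big_ord1 subr0 muleC; congr (_ * _).
    by rewrite !diracE; congr ((nat_of_bool _)%:R)%:E; apply/idP/idP;
      rewrite !inE/= -(ord1 j) mE.
  rewrite ge0_integralZl//.
  - by rewrite integral_powR_shift// subr0 powR1 mule1.
  - apply: measurable_funTS; apply/measurable_EFinP.
    apply: measurable_funM => //; apply: (measurableT_comp (measurable_powR _)).
    exact: measurable_funB.
  - by move=> s _; rewrite lee_fin mulr_ge0 ?powR_ge0// ltW.
exists (dirichlet_measure a); split.
  by move=> A; rewrite dirichlet_measureE.
move=> j jk A mA; have -> : j = ord_max by apply/val_inj; case: jk.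
exact: dirichlet_measure_size_bias.
Qed.

Lemma measurable_pos_embed n (a : n.-tuple R) k :
  measurable_fun setT (@pos_embed R n a k).
Proof.
apply/measurable_fun_tnthP => i.
rewrite (_ : _ \o _ = fun p : k.-tuple R => if (0 < tnth a i)%R
  then nth 0%R p (count (fun y => (0 < y)%R) (take i a)) else 0%R); last first.
  by apply/funext => p; rewrite /= tnth_mktuple.
case: (0 < tnth a i)%R => //;
  have [h|h] := ltnP (count (fun y => (0 < y)%R) (take i a)) k.
  rewrite (_ : (fun p => _) = fun p : k.-tuple R => tnth p (Ordinal h)).
    exact: measurable_tnth.
  by apply/funext => p; rewrite (tnth_nth 0%R).
rewrite (_ : (fun p => _) = cst 0%R)//.
by apply/funext => p; rewrite nth_default// size_tuple.
Qed.

(** If the last parameter vanishes, so do both sides. If it is positive, it is also the last of the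
    positive parameters, and [pos_embed] commutes with [mix], so the identity is transported from
    the subvector of positive parameters. *)
Lemma dirichlet_size_bias n (a : n.+1.-tuple R) :
  (forall i, (0 <= tnth a i)%R) -> (0 < \sum_(i < n.+1) tnth a i)%R ->
  exists nu : {measure set n.+1.-tuple R -> \bar R},
    (forall A, dirichlet a A = nu A) /\
    (forall A, measurable A ->
      \int[nu]_(p in A) (`|tnth p ord_max|)%:E =
      \int[leb]_(s in `]0%R, 1%R])
        ((tnth a ord_max * s `^ (\sum_(i < n.+1) tnth a i - 1))%:E *
         nu (mix ord_max s @^-1` A))).
Proof.
move=> a0 suma; pose pos (y : R) := (0 < y)%R.
pose b := in_tuple [seq y <- a | pos y].
have b0 i : (0 < tnth b i)%R.
  by have := mem_tnth i b; rewrite mem_filter => /andP[].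
have sumb : (\sum_(i < size [seq y <- a | pos y]) tnth b i =
             \sum_(i < n.+1) tnth a i)%R.
  rewrite -(big_tuple _ _ b xpredT id)/= big_filter -(big_tuple _ _ a xpredT
    id).
  rewrite big_mkcond/=; apply: eq_big_seq => y /tnthP[i ->].
  by case: ifPn => // /negP h; apply/eqP;
    rewrite eq_sym eq_le a0 andbT leNgt; apply/negP.
have k0 : (0 < size [seq y <- a | pos y])%N.
  rewrite lt0n; apply/negP => /eqP k0; move: suma.
  by rewrite -sumb big1 ?ltxx// => i; move: (ltn_ord i);
    rewrite [X in (_ < X)%N]k0.
have [nu [nuE nu_sb]] := dirichlet_pos_size_bias k0 b0.
have mphi := @measurable_pos_embed _ a (size [seq y <- a | pos y]).
exists (pushforward_measure nu mphi); split.
  by move=> A; rewrite /dirichlet /pushforward nuE.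
move=> A mA; set phi := @pos_embed R n.+1 a _ in mphi *.
have mabs m (i : 'I_m) : measurable_fun setT (fun p : m.-tuple R => (`|tnth p
  i|)%:E).
  apply/measurable_EFinP.
  exact: (measurableT_comp (@normr_measurable _ _) (measurable_tnth _)).
have mphiA : measurable (phi @^-1` A) by rewrite -[X in measurable X]setTI;
  exact: mphi.
transitivity (\int[nu]_(q in phi @^-1` A) (`|tnth (phi q) ord_max|)%:E).
  rewrite integral_mkcond (ge0_integral_pushforward_measure _ mphi).
  - rewrite [RHS]integral_mkcond; apply: eq_integral => q _.
    by rewrite /patch.
  - by apply/(measurable_restrictT _ mA); apply: measurable_funTS; exact: mabs.
  - by move=> y; apply: erestrict_ge0 => p _; rewrite lee_fin.
have [az|ap] := leP (tnth a ord_max) 0%R.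
  rewrite integral0_eq; last first.
    by move=> q _; rewrite tnth_mktuple ltNge az normr0.
  rewrite integral0_eq// => s _.
  suff -> : tnth a ord_max = 0%R by rewrite mul0r mul0e.
  by apply/eqP; rewrite eq_le az a0.
have aE : a = rcons (take n a) (tnth a ord_max) :> seq R.
  by rewrite (tnth_nth 0%R) -take_nth ?size_tuple// take_oversize// size_tuple.
have bE : [seq y <- a | pos y] =
    rcons [seq y <- take n a | pos y] (tnth a ord_max).
  by rewrite {1}aE filter_rcons /pos ap.
have kE : size [seq y <- a | pos y] = (count pos (take n a)).+1.
  by rewrite bE size_rcons size_filter.
have jk : (count pos (take n a) < size [seq y <- a | pos y])%N by rewrite kE.
pose j := Ordinal jk.
have jE : j.+1 = size [seq y <- a | pos y] by exact: esym.
have bj : tnth b j = tnth a ord_max.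
  rewrite (tnth_nth 0%R)/= {1}bE nth_rcons size_filter ltnn eqxx//.
have phi_max q : tnth (phi q) ord_max = tnth q j.
  by rewrite tnth_mktuple ap (tnth_nth 0%R).
have count_mono i l : (i <= l)%N ->
    (count pos (take i a) <= count pos (take l a))%N.
  move=> il; rewrite -(take_takel _ il) -[X in (_ <= count _
    X)%N](cat_take_drop i).
  by rewrite count_cat leq_addr.
have phi_mix s q : phi (mix j s q) = mix ord_max s (phi q).
  apply: eq_from_tnth => i; rewrite [RHS]tnth_mktuple !tnth_mktuple.
  case: ifPn => [ai|ai]; last first.
    rewrite mulr0 add0r; case: eqP => [ei|_]; last by rewrite mulr0.
    by move: ai; rewrite ei ap.
  have ik : (count pos (take i a) < size [seq y <- a | pos y])%N.
    by rewrite kE ltnS count_mono// -ltnS.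
  rewrite -[LHS](tnth_nth 0%R (mix j s q) (Ordinal ik)) tnth_mktuple.
  rewrite (tnth_nth 0%R)/=; congr (_ + _ * (nat_of_bool _)%:R)%R.
  rewrite -!val_eqE/=; have [->|i_n] := eqVneq (i : nat) n; first exact: eqxx.
  have lt_in : (i < n)%N by rewrite ltn_neqAle i_n -ltnS ltn_ord.
  (* A positive entry at [i < n] is itself counted among the first [n], so its rank is strictly
     below that of the last entry. *)
  apply/negbTE; rewrite ltn_eqF// (leq_trans _ (count_mono _ _ lt_in))//.
  by rewrite (take_nth 0%R) ?size_tuple// -cats1 count_cat/= -tnth_nth /pos ai
    addn1.
under eq_integral do rewrite phi_max.
rewrite (nu_sb j jE _ mphiA); apply: eq_integral => s _.
rewrite bj sumb; congr (_ * _); rewrite (pushforward_measureE _ mphi);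
  congr (nu _).
by apply/seteqP; split => q /=; rewrite phi_mix.
Qed.

End dirichlet_size_bias_general.

(** * Spaces of measures *)

Section sfmeas_measurability.
Context d (X : measurableType d) (R : realType).

Lemma measurable_sfmeas_ev (B : set X) : measurable B ->
  measurable_fun setT (fun mu : sfmeas X R => mu B).
Proof.
move=> mB _ C mC; rewrite setTI; apply: sub_sigma_algebra.
by exists B => //; exists C => //; rewrite setTI.
Qed.

Lemma measurable_fun_sfmeas dT (T : measurableType dT) (D : set T)
    (f : T -> sfmeas X R) :
  (forall B, measurable B -> measurable_fun D (fun t => f t B)) ->
  measurable_fun D f.
Proof.
move=> mf mD; move: (mD); apply: (measurability (\bigcup_(B in measurable)
  preimage_set_system setT ((@sfmeas_ev _ X R) ^~ B) measurable)) => //.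
move=> _ [_ [B mB [C mC <-]] <-]; rewrite setTI.
by apply: (mf B mB mD C mC).
Qed.

(** Elements of [sfmeas] are functions on all sets and may differ on nonmeasurable ones, so
    agreement on measurable sets does not give equality. The sets that do not separate [mu] from
    [nu] nevertheless form a sigma-algebra containing the generators. *)
Lemma sfmeas_ext (mu nu : sfmeas X R) (A : set (sfmeas X R)) :
  (forall B, measurable B -> mu B = nu B) -> measurable A -> A mu <-> A nu.
Proof.
move=> munu; pose H : set (set (sfmeas X R)) := [set A | A mu <-> A nu].
suff : measurable `<=` H by apply.
apply: smallest_sub; last first.
  by move=> _ [B mB [C mC <-]]; rewrite /H/= /sfmeas_ev munu.
split => //.
- by move=> U; rewrite setTD /H/= /setC/=; tauto.
- move=> F HF; split => -[i _ Fi]; exists i => //; exact/(HF i).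
Qed.

(* The absolute values make this a measure for every real [s]; it is only used
   for [s] in [[0, 1]]. *)
Section atom_mix.
Variables (mu : sfmeas X R) (mu_fin : mu setT < +oo) (s : R) (x : X).

Definition atom_mix_fun : set X -> \bar R :=
  measure_add (mscale (NngNum (normr_ge0 s)) mu)
              (mscale (NngNum (normr_ge0 (1 - s)%R)) \d_x).

HB.instance Definition _ := Measure.on atom_mix_fun.

Lemma atom_mix_funE B : atom_mix_fun B =
  (`|s|)%:E * mu B + (`|1 - s|)%:E * \d_x B.
Proof. by rewrite /atom_mix_fun measure_addE. Qed.

Let atom_mix_fin : fin_num_fun atom_mix_fun.
Proof.
move=> B mB; have muB : mu B \is a fin_num.
  by rewrite ge0_fin_numE// (le_lt_trans _ mu_fin)// le_measure// inE.
by rewrite atom_mix_funE diracE fin_numD !fin_numM.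
Qed.

HB.instance Definition _ :=
  Measure_isFinite.Build _ _ _ atom_mix_fun atom_mix_fin.

Definition atom_mix : sfmeas X R := atom_mix_fun.

Lemma atom_mixE B : atom_mix B = (`|s|)%:E * mu B + (`|1 - s|)%:E * \d_x B.
Proof. exact: atom_mix_funE. Qed.

End atom_mix.

End sfmeas_measurability.

(** * Uniqueness of measures on products, and cylinder sets *)

Section pair_measure_unique.
Context d1 d2 (T1 : measurableType d1) (T2 : measurableType d2) (R : realType).

(** Uniqueness on a generating system closed under intersection is used twice: for fixed [B], on the
    measures that send [A] to the mass of the rectangle with sides [A] and [B], and then on the
    rectangles themselves. *)
Lemma pair_measure_unique (G : set (set T1))
    (m1 m2 : {measure set (T1 * T2) -> \bar R}) :
  measurable = <<s G >> -> setI_closed G -> G setT -> m1 setT < +oo ->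
  (forall A B, G A -> measurable B -> m1 (A `*` B) = m2 (A `*` B)) ->
  forall E, measurable E -> m1 E = m2 E.
Proof.
move=> mG GI GT m1oo m12.
have mGA A : G A -> measurable A by move=> GA; rewrite mG;
  exact: sub_sigma_algebra.
have rect A B : measurable A -> measurable B -> m1 (A `*` B) = m2 (A `*` B).
  move=> mA mB.
  have mTB : measurable (@setT T1 `*` B) by exact: measurableX.
  have mfst : measurable_fun setT (@fst T1 T2) by exact: measurable_fst.
  pose n1 := pushforward_measure (mrestr m1 mTB) mfst.
  pose n2 := pushforward_measure (mrestr m2 mTB) mfst.
  have nE (m : {measure set (T1 * T2) -> \bar R}) C :
      mrestr m mTB (fst @^-1` C) = m (C `*` B).
    by congr (m _); apply/seteqP; split => [[? ?] [] ? []|[? ?] []].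
  have n1E C : n1 C = m1 (C `*` B) by exact: nE.
  have n2E C : n2 C = m2 (C `*` B) by exact: nE.
  rewrite -n1E -n2E.
  apply: (measure_unique G (fun=> setT)) => //.
  - by rewrite bigcup_const//; exists 0%N.
  - by move=> C GC; rewrite n1E n2E m12.
  - move=> _; rewrite n1E (le_lt_trans _ m1oo)//.
    by rewrite le_measure// inE.
move=> E mE; apply: (measure_unique
  [set A `*` B | A in measurable & B in measurable] (fun=> setT)) => //.
- by rewrite measurable_prod_measurableType.
- move=> _ _ [A1 mA1 [B1 mB1 <-]] [A2 mA2 [B2 mB2 <-]].
  exists (A1 `&` A2); first exact: measurableI.
  by exists (B1 `&` B2); [exact: measurableI|rewrite setXI].
- by move=> _; exists setT => //; exists setT => //; rewrite setXTT.
- by rewrite bigcup_const//; exists 0%N.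
- by move=> _ [A mA [B mB <-]]; exact: rect.
Qed.

End pair_measure_unique.

Section cylinders.
Context d (X : measurableType d) (R : realType).

Definition cylinder k (f : 'I_k -> set X * set (\bar R)) : set (sfmeas X R) :=
  [set mu | forall i, (f i).2 (mu (f i).1)].

(** The evaluated sets are arbitrary, not the cells of a partition, so an intersection of two
    cylinders is obtained by concatenating their constraints. *)
Definition cylinders : set (set (sfmeas X R)) :=
  [set U | exists k (f : 'I_k -> set X * set (\bar R)),
     (forall i, measurable (f i).1 /\ measurable (f i).2) /\ U = cylinder f].

Lemma cylindersT : cylinders setT.
Proof.
exists 0%N, (fun=> (setT, setT)); split; first by case.
by apply/seteqP; split => // mu _ [].
Qed.

Lemma cylinders_setI : setI_closed cylinders.
Proof.
move=> _ _ [k1 [f1 [mf1 ->]]] [k2 [f2 [mf2 ->]]].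
exists (k1 + k2)%N, (fun i =>
  match fintype.split i with inl a => f1 a | inr b => f2 b end).
split; first by move=> i; case: (fintype.split i).
apply/seteqP; split => [mu [h1 h2] i|mu h]; first by case: (fintype.split i).
split => i.
  by have := h (unsplit (inl i)); rewrite unsplitK.
by have := h (unsplit (inr i)); rewrite unsplitK.
Qed.

Lemma measurable_cylinder U : cylinders U -> measurable U.
Proof.
move=> [k [f [mf ->]]].
rewrite (_ : cylinder f = \bigcap_(i in [set: 'I_k])
   ((fun mu : sfmeas X R => mu (f i).1) @^-1` (f i).2)); last first.
  by apply/seteqP; split => [mu h i _|mu h i]; apply: h.
apply: fin_bigcap_measurable => // i _; rewrite -[X in measurable X]setTI.
by apply: measurable_sfmeas_ev => //; exact: (mf i).1 || exact: (mf i).2.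
Qed.

Lemma sfmeas_measurableE : @measurable _ (sfmeas X R) = <<s cylinders >>.
Proof.
apply/seteqP; split; last first.
  apply: smallest_sub; first exact: sigma_algebra_measurable.
  exact: measurable_cylinder.
apply: smallest_sub; first exact: smallest_sigma_algebra.
move=> _ [B mB [C mC <-]]; apply: sub_sigma_algebra.
exists 1%N, (fun=> (B, C)); split => //.
by apply/seteqP; split => [mu [_ h] i|mu h]//; split => //; exact: (h ord0).
Qed.

End cylinders.

(** * Measurability of atoms and of their removal *)

Section borel_atoms.
Context (R : realType) d (X : measurableType d).
Hypothesis XR : borel_space R X.

Lemma borel_space_set1 (x : X) : measurable [set x].
Proof.
have [f [g [_ _ mf _ fK]]] := XR.
rewrite (_ : [set x] = f @^-1` [set f x]).
  by rewrite -[X in measurable X]setTI; exact: mf.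
by apply/seteqP; split => y /=; [move=> ->|exact: (can_inj fK)].
Qed.

(** The embedding [f] into the reals is injective, so the graph is the zero set of a measurable real
    function. *)
Lemma borel_space_graph dT (T : measurableType dT) (h : T -> X) :
  measurable_fun setT h -> measurable [set z : T * X | h z.1 = z.2].
Proof.
have [f [g [_ _ mf _ fK]]] := XR; move=> mh.
have mD : measurable_fun setT (fun z : T * X => f (h z.1) - f z.2)%R.
  apply: measurable_funB.
    exact: (measurableT_comp mf (measurableT_comp mh measurable_fst)).
  exact: (measurableT_comp mf measurable_snd).
rewrite (_ : mkset _ = (fun z : T * X => f (h z.1) - f z.2)%R @^-1` [set 0%R]).
  by rewrite -[X in measurable X]setTI; exact: mD.
apply/seteqP; split => z /=; first by move=> ->; rewrite subrr.
by move/eqP; rewrite subr_eq0 => /eqP/(can_inj fK).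
Qed.

Let D1 : set (sfmeas X R * X)%type :=
  [set z : (sfmeas X R * X)%type | z.1 setT = 1].

Lemma measurable_prob_sfmeas : measurable D1.
Proof.
have mT : measurable_fun setT (fun z : (sfmeas X R * X)%type => z.1 setT).
  exact: (measurableT_comp (measurable_sfmeas_ev measurableT) measurable_fst).
rewrite -[X in measurable X]setTI.
exact: (mT measurableT [set 1] (emeasurable_set1 _)).
Qed.

(** The tautological kernel, which sends a measure to itself. It is cut to zero away from the
    probability measures in order to be uniformly bounded. *)
Definition prob_kernel_of (z : (sfmeas X R * X)%type) : {measure set X -> \bar
  R} :=
  if `[< D1 z >] then z.1 else mzero.

Let measurable_prob_kernel_of U : measurable U ->
  measurable_fun setT (prob_kernel_of ^~ U).
Proof.
move=> mU; rewrite (_ : prob_kernel_of ^~ U = (fun z => z.1 U) \_ D1).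
  apply/(measurable_restrictT _ measurable_prob_sfmeas);
    apply: measurable_funTS.
  exact: (measurableT_comp (measurable_sfmeas_ev mU) measurable_fst).
apply/funext => z; rewrite /prob_kernel_of /patch /=.
by case: asboolP => h; [rewrite mem_set|rewrite memNset].
Qed.

HB.instance Definition _ :=
  isKernel.Build _ _ _ _ _ prob_kernel_of measurable_prob_kernel_of.

Let prob_kernel_of_uub : measure_fam_uub prob_kernel_of.
Proof.
(* The uniform bound is strict, so 1 would not do. *)
exists 2%R => z; rewrite /prob_kernel_of; case: asboolP => [z1|_].
  by rewrite [X in X < _]z1 lte_fin ltr1n.
by rewrite /mzero/= lte_fin.
Qed.

HB.instance Definition _ :=
  Kernel_isFinite.Build _ _ _ _ _ prob_kernel_of prob_kernel_of_uub.

(** The singleton of [z.2] is the section at [z] of the graph of the second projection, and a finite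
    kernel evaluated at the sections of a measurable set is measurable. *)
Lemma measurable_atom :
  measurable_fun D1 (fun z : (sfmeas X R * X)%type => z.1 [set z.2]).
Proof.
have msnd : measurable_fun setT (@snd (sfmeas X R) X) by exact: measurable_snd.
have mG := borel_space_graph msnd.
have := measurable_fun_xsection_finite_kernel prob_kernel_of (mem_set mG).
move=> /(measurable_funS measurableT (@subsetT _ D1)).
apply: eq_measurable_fun => z /set_mem zD.
have kE : prob_kernel_of z = z.1 :> {measure set X -> \bar R}.
  by rewrite /prob_kernel_of asboolT.
rewrite -[LHS]/(prob_kernel_of z _) kE; congr (z.1 _).
by apply/seteqP; split => y; rewrite /xsection/= inE.
Qed.

Lemma measurable_del_atom :
  measurable_fun D1 (fun z : (sfmeas X R * X)%type => del_atom z.1 z.2).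
Proof.
apply: measurable_fun_sfmeas => B mB.
have mD1 := measurable_prob_sfmeas.
have mfine : measurable_fun D1 (fun z : (sfmeas X R * X)%type => fine (z.1 [set
  z.2])).
  exact: (measurableT_comp (fine_measurable measurableT) measurable_atom).
(* The inverse is replaced by the power with exponent -1, which agrees with it on nonnegative reals,
   including the value 0 at 0. *)
apply: (@eq_measurable_fun _ _ _ _ _ (fun z : (sfmeas X R * X)%type =>
  (((1 - fine (z.1 [set z.2])) `^ (-1))%:E *
   (z.1 B - z.1 [set z.2] * (\1_B z.2)%:E)))).
  move=> z /set_mem z1; rewrite del_atom_prob//; last exact: borel_space_set1.
  rewrite diracE powR_inv1// subr_ge0.
  have le1 : z.1 [set z.2] <= 1.
    by rewrite -[leRHS]z1 le_measure ?inE//; exact: borel_space_set1.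
  by rewrite -lee_fin fineK// ge0_fin_numE// (le_lt_trans le1)// ltry.
apply: emeasurable_funM.
  apply/measurable_EFinP.
  apply: (measurableT_comp (measurable_powR _)).
  exact: measurable_funB.
apply: emeasurable_funB.
  apply: measurable_funTS.
  exact: (measurableT_comp (measurable_sfmeas_ev mB) measurable_fst).
apply: emeasurable_funM; first exact: measurable_atom.
apply/measurable_EFinP; apply: measurable_funTS.
have mB1 : measurable_fun setT (\1_B : X -> R) by exact: measurable_indic.
exact: (measurableT_comp mB1 measurable_snd).
Qed.

End borel_atoms.

(** * The joint law of a Dirichlet process and its size-biased pick *)

Section beta_measure.
Context {R : realType}.
Local Notation leb := (@lebesgue_measure R).
Variable theta : R.
Hypothesis theta0 : (0 < theta)%R.

Let f (s : measurableTypeR R) : R := (s `^ (theta - 1) * \1_(`]0%R, 1%R]) s)%R.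

Let f0 s : (0 <= f s)%R.
Proof. by rewrite mulr_ge0// powR_ge0. Qed.

Let mf : measurable_fun setT f.
Proof.
apply: measurable_funM; first exact: measurable_powR.
exact: measurable_indic.
Qed.

Let m : {measure set (measurableTypeR R) -> \bar R} :=
  density_measure leb f0 mf.

Let integral_m (h : measurableTypeR R -> \bar R) :
  (forall s, 0 <= h s) -> measurable_fun setT h ->
  \int[m]_s h s = \int[leb]_(s in `]0%R, 1%R]) ((s `^ (theta - 1))%:E * h s).
Proof.
move=> h0 mh; rewrite ge0_integral_density_measure// [RHS]integral_mkcond.
by apply: eq_integral => s _; rewrite epatch_indic /f EFinM muleA (muleC (h s)).
Qed.

Let m_fin : fin_num_fun (m : set (measurableTypeR R) -> \bar R).
Proof.
apply: lty_fin_num_fun; rewrite -[X in m X]setIT -integral_indic//.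
rewrite integral_m//; last exact/measurable_EFinP/measurable_indic.
rewrite (_ : \int[leb]_(s in _) _ = (theta^-1)%:E *
    \int[leb]_(s in `]0%R, 1%R]) (theta * (s - 0) `^ (theta - 1))%:E).
  by rewrite integral_powR_shift// -EFinM ltry.
rewrite -ge0_integralZl//.
- apply: eq_integral => s _;
  rewrite indicT mule1 subr0 -EFinM mulrA mulVf ?mul1r//.
  by rewrite gt_eqF.
- apply: measurable_funTS; apply/measurable_EFinP; apply: measurable_funM => //.
  by apply: (measurableT_comp (measurable_powR _)); exact: measurable_funB.
- by move=> s _; rewrite lee_fin mulr_ge0 ?powR_ge0// ltW.
- by rewrite lee_fin invr_ge0 ltW.
Qed.

(* An unnormalized Beta(theta, 1) distribution, of total mass [1 / theta]. *)
Definition beta_measure : {finite_measure set (measurableTypeR R) -> \bar R} :=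
  HB.pack (Measure.sort m) (Measure_isFinite.Build _ _ _ (Measure.sort m)
    m_fin).

Lemma ge0_integral_beta_measure (h : measurableTypeR R -> \bar R) :
  (forall s, 0 <= h s) -> measurable_fun setT h ->
  \int[beta_measure]_s h s =
  \int[leb]_(s in `]0%R, 1%R]) ((s `^ (theta - 1))%:E * h s).
Proof. exact: integral_m. Qed.

End beta_measure.

Lemma big_setU_ordP T n (p : pred 'I_n) (B : 'I_n -> set T) x :
  (\big[setU/set0]_(i < n | p i) B i) x <-> exists2 i, p i & B i x.
Proof.
split; last by move=> [i pi Bx]; rewrite (bigD1 i)//=; left.
by elim/big_rec : _ => [//|i U pi IH [Bx|/IH//]]; exists i.
Qed.

Section tuples.
Context d (X : measurableType d) (R : realType).

Definition eval_tuple n (B : 'I_n -> set X) (mu : sfmeas X R) : n.-tuple (\bar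
  R) :=
  [tuple mu (B i) | i < n].

Lemma measurable_eval_tuple n (B : 'I_n -> set X) :
  (forall i, measurable (B i)) -> measurable_fun setT (eval_tuple B).
Proof.
move=> mB; apply/measurable_fun_tnthP => i.
rewrite (_ : _ \o _ = fun mu : sfmeas X R => mu (B i));
  first exact: measurable_sfmeas_ev.
by apply/funext => mu; rewrite /= tnth_mktuple.
Qed.

(** The effect of [atom_mix] on the masses of a partition. Its absolute values are those of
    [atom_mix]; for [s] in the unit interval it restricts to [mix] on real tuples. *)
Definition emix n (j : 'I_n) (s : R) (t : n.-tuple (\bar R)) : n.-tuple (\bar
  R) :=
  [tuple (`|s|)%:E * tnth t i + (`|1 - s|)%:E * ((i == j)%:R)%:E | i < n].

Lemma measurable_emix dT (T : measurableType dT) n (j : 'I_n) (s : T -> R)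
    (t : T -> n.-tuple (\bar R)) :
  measurable_fun setT s -> measurable_fun setT t ->
  measurable_fun setT (fun x => emix j (s x) (t x)).
Proof.
move=> ms mt; apply/measurable_fun_tnthP => i.
rewrite (_ : _ \o _ = fun x => (`|s x|)%:E * tnth (t x) i +
   (`|1 - s x|)%:E * ((i == j)%:R)%:E); last first.
  by apply/funext => x; rewrite /= tnth_mktuple.
apply: emeasurable_funD.
  apply: emeasurable_funM; last exact: (measurableT_comp (measurable_tnth i)).
  by apply/measurable_EFinP; apply: (measurableT_comp (@normr_measurable _ _)).
apply: emeasurable_funM => //; apply/measurable_EFinP.
by apply: (measurableT_comp (@normr_measurable _ _)); exact: measurable_funB.
Qed.

Lemma emix_mix n (j : 'I_n) (s : R) (p : n.-tuple R) : (0 <= s <= 1)%R ->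
  emix j s [tuple of map EFin p] = [tuple of map EFin (mix j s p)].
Proof.
move=> /andP[s0 s1]; apply: eq_from_tnth => i.
by rewrite tnth_mktuple !tnth_map tnth_ord_tuple !ger0_norm ?subr_ge0.
Qed.

Lemma measurable_map_EFin n :
  measurable_fun setT (fun p : n.-tuple R => [tuple of map EFin p]).
Proof.
apply/measurable_fun_tnthP => i.
rewrite (_ : _ \o _ = fun p : n.-tuple R => (tnth p i)%:E).
  by apply/measurable_EFinP; exact: measurable_tnth.
by apply/funext => p; rewrite /= tnth_map.
Qed.

Lemma eval_tuple_atom_mix n (B : 'I_n -> set X) (j : 'I_n) (mu : sfmeas X R)
    (mu_fin : mu setT < +oo) s x :
  trivIset setT B -> B j x ->
  eval_tuple B (atom_mix mu_fin s x) = emix j s (eval_tuple B mu).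
Proof.
move=> tB Bx; apply: eq_from_tnth => i; rewrite !tnth_mktuple atom_mixE.
congr (_ + _ * _); rewrite diracE; have [->|ij] := eqVneq i j.
  by rewrite mem_set.
rewrite memNset// => Bix; move/eqP : ij; apply.
by apply: tB => //; exists x.
Qed.

End tuples.

Section size_biased.
Context (R : realType) d (X : measurableType d).
Context (rho : {finite_measure set X -> \bar R}).
Context dO (Omega : measurableType dO) (P : probability Omega R).
Variables (zeta : Omega -> sfmeas X R) (tau : Omega -> X).
Hypotheses (mzeta : measurable_fun setT zeta) (mtau : measurable_fun setT tau).
Hypotheses (rho0 : 0 < rho setT) (zeta1 : forall w, zeta w setT = 1).
Hypothesis zetaD : is_dirichlet_process P rho zeta.
Hypothesis tauE : forall B, measurable B ->
  is_cond_prob P (tau @^-1` B) zeta (fun w => zeta w B).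

Local Notation leb := (@lebesgue_measure R).
Let theta : R := fine (rho setT).

Let theta0 : (0 < theta)%R.
Proof. by rewrite fine_gt0// rho0/=;
  exact: fin_num_fun_lty (fin_num_measure _). Qed.

Definition size_bias_measure := beta_measure theta0.
Local Notation beta := size_bias_measure.

Let zeta_fin w : zeta w setT < +oo.
Proof. by rewrite zeta1 ltry. Qed.

Let Z (w : Omega) : (sfmeas X R * X)%type := (zeta w, tau w).
Let mZ : measurable_fun setT Z.
Proof. exact: measurable_fun_pair. Qed.

Let H (z : (X * measurableTypeR R) * Omega) : (sfmeas X R * X)%type :=
  (atom_mix (zeta_fin z.2) z.1.2 z.1.1, z.1.1).
Let mH : measurable_fun setT H.
Proof.
have m11 : measurable_fun setT (fun z : (X * measurableTypeR R) * Omega =>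
  z.1.1).
  exact: (measurableT_comp measurable_fst measurable_fst).
have m12 : measurable_fun setT (fun z : (X * measurableTypeR R) * Omega =>
  z.1.2).
  exact: (measurableT_comp measurable_snd measurable_fst).
apply: measurable_fun_pair => //; apply: measurable_fun_sfmeas => B mB.
under eq_fun do rewrite atom_mixE diracE.
apply: emeasurable_funD; apply: emeasurable_funM.
- apply/measurable_EFinP.
  exact: (measurableT_comp (@normr_measurable _ _) m12).
- have mzB : measurable_fun setT (fun w => zeta w B).
    exact: (measurableT_comp (measurable_sfmeas_ev mB) mzeta).
  exact: (measurableT_comp mzB measurable_snd).
- apply/measurable_EFinP; apply: (measurableT_comp (@normr_measurable _ _)).
  exact: measurable_funB.
- apply/measurable_EFinP.
  have mB1 : measurable_fun setT (\1_B : X -> R) by exact: measurable_indic.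
  exact: (measurableT_comp mB1 m11).
Qed.

Let Q1 : {measure set (sfmeas X R * X)%type -> \bar R} :=
  pushforward_measure P mZ.
(** The mixture side of the identity: position of the atom, weight and measure are independent under
    the product measure. *)
Let Q2 : {measure set (sfmeas X R * X)%type -> \bar R} :=
  pushforward_measure ((rho \x beta) \x P) mH.

Let measurable_H_section E x : measurable E -> measurable_fun setT
  (fun s : measurableTypeR R => P [set w | E (atom_mix (zeta_fin w) s x, x)]).
Proof.
move=> mE; have mHE : measurable (H @^-1` E).
  by rewrite -[X in measurable X]setTI; exact: mH.
have mphi : measurable_fun setT (P \o xsection (H @^-1` E)).
  exact: measurable_fun_xsection.
rewrite (_ : (fun s => _) = (P \o xsection (H @^-1` E)) \o pair x).
  by apply: (measurableT_comp mphi).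
apply/funext => s /=; congr (P _).
by apply/seteqP; split => w; rewrite /xsection/= inE.
Qed.

Let Q1E E : Q1 E = P [set w | E (zeta w, tau w)].
Proof. by []. Qed.

Let Q2E E : measurable E -> Q2 E = \int[rho]_x \int[beta]_s
  P [set w | E (atom_mix (zeta_fin w) s x, x)].
Proof.
move=> mE; have mHE : measurable (H @^-1` E).
  by rewrite -[X in measurable X]setTI; exact: mH.
have mphi : measurable_fun setT (P \o xsection (H @^-1` E)).
  exact: measurable_fun_xsection.
have phi0 z : 0 <= (P \o xsection (H @^-1` E)) z by exact: measure_ge0.
rewrite /Q2 (pushforward_measureE _ mH).
transitivity (\int[rho]_x \int[beta]_s (P \o xsection (H @^-1` E)) (x, s)).
  exact: (@fubini_tonelli1 _ _ X (measurableTypeR R) R rho beta _ mphi phi0).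
apply: eq_integral => x _; apply: eq_integral => s _ /=; congr (P _).
by apply/seteqP; split => w; rewrite /xsection/= inE.
Qed.

(** Conditioning on [zeta] turns the event that [tau] lies in the last cell into the weight
    [zeta (B ord_max)], the last coordinate of a Dirichlet vector. Its size-biasing identity then
    meets [Q2], because an atom placed in the last cell acts on the masses as a mixture with the
    last vertex. *)
Let cell_last n (B : 'I_n.+1 -> set X) (A : set (n.+1.-tuple (\bar R))) :
  (forall i, measurable (B i)) -> trivIset setT B -> \bigcup_i B i = setT ->
  measurable A ->
  Q1 [set z | A (eval_tuple B z.1) /\ B ord_max z.2] =
  Q2 [set z | A (eval_tuple B z.1) /\ B ord_max z.2].
Proof.
move=> mB tB UB mA; set E := [set z | _].
have mev := measurable_eval_tuple (R := R) mB.
have mE : measurable E.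
  apply: measurableI; rewrite -[X in measurable X]setTI.
    exact: (measurableT_comp mev measurable_fst).
  have msnd : measurable_fun setT (@snd (sfmeas X R) X)
    by exact: measurable_snd.
  exact: msnd.
have rho_fin C : measurable C -> rho C \is a fin_num by exact: fin_num_measure.
pose a : n.+1.-tuple R := [tuple fine (rho (B i)) | i < n.+1].
have a0 i : (0 <= tnth a i)%R by rewrite tnth_mktuple fine_ge0.
have suma : (\sum_(i < n.+1) tnth a i)%R = theta.
  apply: EFin_inj; rewrite -sumEFin /theta fineK ?rho_fin//.
  under eq_bigr do rewrite tnth_mktuple fineK ?rho_fin//.
  rewrite -(measure_bigsetU_ord rho xpredT)//; congr (rho _).
  apply/seteqP; split => // x _; apply/big_setU_ordP.
  have [i _ Bx] : (\bigcup_i B i) x by rewrite UB.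
  by exists i.
have suma0 : (0 < \sum_(i < n.+1) tnth a i)%R by rewrite suma.
have [nu [nuE nuB]] := dirichlet_size_bias a0 suma0.
pose T w := eval_tuple B (zeta w).
have mT : measurable_fun setT T by exact: (measurableT_comp mev).
have mEF := @measurable_map_EFin R n.+1.
have law (C : set (n.+1.-tuple (\bar R))) : measurable C ->
    P (T @^-1` C) = nu ((fun p : n.+1.-tuple R => [tuple of map EFin p]) @^-1`
      C).
  move=> mC; have := zetaD (ltn0Sn n) mB tB UB mC.
  by rewrite /pushforward nuE.
pose g := (fun t : n.+1.-tuple (\bar R) => `|tnth t ord_max|) \_ A.
have g0 t : 0 <= g t by apply: erestrict_ge0 => ? _; exact: abse_ge0.
have mg : measurable_fun setT g.
  apply/(measurable_restrictT _ mA); apply: measurable_funTS.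
  by apply: measurableT_comp => //; exact: measurable_tnth.
have -> : Q1 E = \int[P]_w g (T w).
  rewrite Q1E; have mTA : measurable (T @^-1` A).
    by rewrite -[X in measurable X]setTI; exact: mT.
  rewrite (_ : [set w | _] = tau @^-1` B ord_max `&` zeta @^-1` (eval_tuple B
    @^-1` A)).
    rewrite -(tauE (mB ord_max)).2; last first.
      by rewrite -[X in measurable X]setTI; exact: mev.
    rewrite [LHS]integral_mkcond; apply: eq_integral => w _.
    rewrite /g /patch -[w \in _]/(w \in T @^-1` A).
    rewrite (_ : (w \in T @^-1` A) = (T w \in A)); last by rewrite /in_mem.
    by case: ifPn => // _; rewrite tnth_mktuple gee0_abs.
  by rewrite setIC.
have -> : \int[P]_w g (T w) = \int[nu]_p g [tuple of map EFin p].
  rewrite -(ge0_integral_pushforward_measure _ mT)//.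
  rewrite -(ge0_integral_pushforward_measure _ mEF)//.
  by apply: eq_measure_integral => C mC _; exact: law.
have mEFA : measurable ((fun p : n.+1.-tuple R => [tuple of map EFin p]) @^-1`
  A).
  by rewrite -[X in measurable X]setTI; exact: mEF.
transitivity (\int[nu]_(p in (fun p : n.+1.-tuple R => [tuple of map EFin p])
  @^-1` A)
    (`|tnth p ord_max|)%:E).
  rewrite [RHS]integral_mkcond; apply: eq_integral => p _.
  rewrite /g /patch; have [pA|pA] := pselect (A [tuple of map EFin p]).
    by rewrite !mem_set// tnth_map.
  by rewrite !memNset.
rewrite (nuB _ mEFA) suma Q2E//.
pose pS (s : measurableTypeR R) := P (T @^-1` (emix ord_max s @^-1` A)).
have mpS : measurable_fun setT pS.
  pose S := [set z : measurableTypeR R * Omega | A (emix ord_max z.1 (T z.2))].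
  have mS : measurable S.
    rewrite -[X in measurable X]setTI; apply: measurable_emix => //.
    exact: (measurableT_comp mT measurable_snd).
  rewrite (_ : pS = P \o xsection S); first exact: measurable_fun_xsection.
  apply/funext => s /=; congr (P _).
  by apply/seteqP; split => w; rewrite /xsection/= inE.
have mem s : measurable_fun setT (@emix R n.+1 ord_max s).
  by apply: measurable_emix => //; exact: measurable_cst.
(* The event depends on [x] only through the cell containing it, so the integral over [x]
   contributes [rho (B ord_max)], the last parameter. *)
transitivity (\int[rho]_x ((\1_(B ord_max) x)%:E * \int[beta]_s pS s));
  last first.
  apply: eq_integral => x _; have [xB|xB] := boolP (x \in B ord_max).
    rewrite indicE xB mul1e; apply: eq_integral => s _; congr (P _).
    move/set_mem : xB => xB.
    by apply/seteqP; split => w; rewrite /E/= (eval_tuple_atom_mix _ _ tB xB)//;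
      case.
  rewrite indicE (negbTE xB) mul0e integral0_eq// => s _.
  rewrite (_ : [set w | _] = set0) ?measure0//.
  by apply/seteqP; split => w //= -[_ /mem_set]; exact/negP.
rewrite ge0_integralZr//; last 2 first.
  exact/measurable_EFinP/measurable_indic.
  by apply: integral_ge0.
rewrite integral_indic// setIT ge0_integral_beta_measure//.
rewrite [X in _ = X * _](_ : _ = (fine (rho (B ord_max)))%:E); last first.
  by rewrite fineK// rho_fin.
rewrite -ge0_integralZl//; last 3 first.
- apply: emeasurable_funM; last exact: measurable_funTS.
  by apply/measurable_EFinP; apply: measurable_funTS; exact: measurable_powR.
- by move=> s _; rewrite mule_ge0// lee_fin powR_ge0.
- by rewrite lee_fin fine_ge0.
apply: eq_integral => s; rewrite inE/= in_itv/= => /andP[s0 s1].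
rewrite EFinM muleA /a tnth_mktuple; congr (_ * _).
rewrite /pS law; last by rewrite -[X in measurable X]setTI; exact: mem.
by congr (nu _); apply/seteqP; split => p /=; rewrite emix_mix// ltW.
Qed.

(** The transposition of [j] and the last index is applied to the partition, which remains one, and
    is undone inside [A]. *)
Let cell n (B : 'I_n -> set X) (A : set (n.-tuple (\bar R))) (j : 'I_n) :
  (forall i, measurable (B i)) -> trivIset setT B -> \bigcup_i B i = setT ->
  measurable A ->
  Q1 [set z | A (eval_tuple B z.1) /\ B j z.2] =
  Q2 [set z | A (eval_tuple B z.1) /\ B j z.2].
Proof.
case: n B A j => [|n] B A j mB tB UB mA; first by case: j.
pose pi := tperm j ord_max.
pose perm_t (t : n.+1.-tuple (\bar R)) := [tuple tnth t (pi i) | i < n.+1].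
have mperm : measurable_fun setT perm_t.
  apply/measurable_fun_tnthP => i.
  rewrite (_ : _ \o _ = fun t => tnth t (pi i)); first exact: measurable_tnth.
  by apply/funext => t; rewrite /= tnth_mktuple.
have -> : [set z | A (eval_tuple B z.1) /\ B j z.2] =
    [set z | (perm_t @^-1` A) (eval_tuple (B \o pi) z.1) /\ (B \o pi) ord_max
      z.2].
  have permE (mu : sfmeas X R) : perm_t (eval_tuple (B \o pi) mu) = eval_tuple
    B mu.
    by apply: eq_from_tnth => i; rewrite !tnth_mktuple /= tpermK.
  by apply/seteqP; split => z /=; rewrite permE tpermR.
apply: cell_last.
- by move=> i; exact: mB.
- move=> i i' _ _ [x [Bx Bx']]; apply: (@perm_inj _ pi).
  by apply: tB => //; exists x.
- apply/seteqP; split => // x _;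
  have [i _ Bx] : (\bigcup_i B i) x by rewrite UB.
  by exists (pi i) => //=; rewrite tpermK.
- by rewrite -[X in measurable X]setTI; exact: mperm.
Qed.

(** Points are sorted by which of the finitely many sets contain them. Each set is a disjoint union
    of the resulting cells, so its mass is a sum of cell masses, and the event splits along the
    cells inside [D]. *)
Let cylinder_setX (U : set (sfmeas X R)) (D : set X) :
  cylinders U -> measurable D -> Q1 (U `*` D) = Q2 (U `*` D).
Proof.
move=> [k [f [mf ->]]] mD.
pose g (i : option 'I_k) : set X := if i is Some i' then (f i').1 else D.
have mg i : measurable (g i) by case: i => [i|]//; exact: (mf i).1.
(* The membership pattern of [x], with index [None] for [D]. All patterns are enumerated; the cell
   of an unrealized one is empty and has parameter 0. *)
pose sig (x : X) : {ffun option 'I_k -> bool} := [ffun i => `[< g i x >]].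
pose N := #|{: {ffun option 'I_k -> bool}}|.
pose B (l : 'I_N) : set X := [set x | sig x = enum_val l].
have mB l : measurable (B l).
  rewrite (_ : B l = \bigcap_(i in [set: option 'I_k])
      [set x | `[< g i x >] = enum_val l i]).
    apply: fin_bigcap_measurable => // i _; case: (enum_val l i).
      rewrite (_ : mkset _ = g i)//.
      by apply/seteqP; split => x /=; [move/asboolP|move=> ?; exact/asboolP].
    rewrite (_ : mkset _ = ~` g i); first exact: measurableC.
    by apply/seteqP; split => x /=; [move/asboolPn|move=> ?; exact/asboolPn].
  apply/seteqP; split => [x xl i _ /=|x xl].
    by rewrite -xl ffunE.
  by apply/ffunP => i; rewrite ffunE; exact: xl.
have tB : trivIset setT B.
  by move=> l l' _ _ [x [xl xl']]; apply: enum_val_inj; rewrite -xl -xl'.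
have UB : \bigcup_l B l = setT.
  by apply/seteqP; split => // x _; exists (enum_rank (sig x));
    rewrite // /B/= enum_rankK.
have gE i : g i = \big[setU/set0]_(l < N | enum_val l i) B l.
  apply/seteqP; split => x.
    move=> gx; apply/big_setU_ordP; exists (enum_rank (sig x)); last first.
      by rewrite /B/= enum_rankK.
    by rewrite enum_rankK ffunE; exact/asboolP.
  by move=> /big_setU_ordP[l + xl]; rewrite -xl ffunE => /asboolP.
pose A := [set t : N.-tuple (\bar R) |
  forall i : 'I_k, (f i).2 (\sum_(l < N | enum_val l (Some i)) tnth t l)].
have mA : measurable A.
  rewrite (_ : A = \bigcap_(i in [set: 'I_k]) ((fun t : N.-tuple (\bar R) =>
      \sum_(l < N | enum_val l (Some i)) tnth t l) @^-1` (f i).2)); last first.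
    by apply/seteqP; split => [t h i _|t h i]; apply: h.
  apply: fin_bigcap_measurable => // i _; rewrite -[X in measurable X]setTI.
  have msum : measurable_fun setT (fun t : N.-tuple (\bar R) =>
      \sum_(l < N | enum_val l (Some i)) tnth t l).
    under eq_fun do rewrite big_mkcond.
    apply: emeasurable_sum => l; case: (enum_val l (Some i)) => //.
    exact: measurable_tnth.
  exact: (msum measurableT _ (mf i).2).
pose E l := [set z : (sfmeas X R * X)%type | A (eval_tuple B z.1) /\ B l z.2].
have mE l : measurable (E l).
  apply: measurableI; rewrite -[X in measurable X]setTI.
    exact: (measurableT_comp (measurable_eval_tuple (R :=
      R) mB) measurable_fst).
  have msnd : measurable_fun setT (@snd (sfmeas X R) X)
    by exact: measurable_snd.
  exact: msnd.
have tE : trivIset setT E.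
  by move=> l l' _ _ [z [[_ zl] [_ zl']]]; apply: tB => //; exists z.2.
have -> : cylinder f `*` D = \big[setU/set0]_(l < N | enum_val l None) E l.
  have AE (mu : sfmeas X R) : A (eval_tuple B mu) <-> cylinder f mu.
    have sumE i : mu (f i).1 =
        \sum_(l < N | enum_val l (Some i)) tnth (eval_tuple B mu) l.
      under eq_bigr do rewrite tnth_mktuple.
      by rewrite -measure_bigsetU_ord// -gE.
    by split => h i; have := h i; rewrite /= sumE.
  apply/seteqP; split => z.
    move=> [/AE zA]; rewrite -[D]/(g None) gE => /big_setU_ordP[l lN zl].
    by apply/big_setU_ordP; exists l.
  move=> /big_setU_ordP[l lN [/AE zA zl]]; split => //.
  by rewrite -[D]/(g None) gE; apply/big_setU_ordP; exists l.
rewrite !measure_bigsetU_ord//; apply: eq_bigr => l _; exact: cell.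
Qed.

Let Q1Q2 E : measurable E -> Q1 E = Q2 E.
Proof.
apply: (pair_measure_unique (@sfmeas_measurableE d X R)).
- exact: cylinders_setI.
- exact: cylindersT.
- rewrite Q1E (_ : [set w | _] = setT); last by apply/seteqP; split.
  by rewrite probability_setT ltry.
- by move=> U D cU mD; exact: cylinder_setX.
Qed.

(** The mean of [zeta B] is the probability that [tau] lies in [B], which the joint law makes a
    multiple of [rho B]; a nonnegative variable of mean zero vanishes almost surely. *)
Let zeta_null (B : set X) : measurable B -> rho B = 0 ->
  P (~` [set w | zeta w B = 0]) = 0.
Proof.
move=> mB rB; have mzB : measurable_fun setT (fun w => zeta w B).
  exact: (measurableT_comp (measurable_sfmeas_ev mB) mzeta).
have int0 : \int[P]_w zeta w B = 0.
  have := (tauE mB).2 setT measurableT; rewrite preimage_setT setIT => ->.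
  have mTB : measurable ([set: sfmeas X R] `*` B) by exact: measurableX.
  transitivity (Q1 ([set: sfmeas X R] `*` B)).
    by rewrite Q1E; congr (P _); apply/seteqP; split => w //= [].
  rewrite Q1Q2// Q2E//.
  transitivity (\int[rho]_x ((\1_B x)%:E * \int[beta]_s P setT)).
    apply: eq_integral => x _; rewrite indicE.
    have [xB|xB] := boolP (x \in B).
      rewrite mul1e; apply: eq_integral => s _; congr (P _).
      by apply/seteqP; split => // w _; split => //; exact/set_mem.
    rewrite mul0e integral0_eq// => s _.
    rewrite (_ : [set w | _] = set0) ?measure0//.
    by apply/seteqP; split => w //= -[_ /mem_set]; exact/negP.
  rewrite ge0_integralZr//; last 2 first.
    exact/measurable_EFinP/measurable_indic.
    by apply: integral_ge0.
  by rewrite integral_indic// setIT [X in X * _]rB mul0e.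
have mN : measurable (~` [set w | zeta w B = 0]).
  apply: measurableC; rewrite -[X in measurable X]setTI.
  exact: (mzB measurableT [set 0] (emeasurable_set1 _)).
have intabs : \int[P]_w `|zeta w B| = 0.
  by rewrite -[RHS]int0; apply: eq_integral => w _; rewrite gee0_abs.
have [N [mN' PN' sub]] := (ae_eq_integral_abs P measurableT mzB).1 intabs.
apply/eqP; rewrite eq_le measure_ge0 andbT -[leRHS]PN'.
rewrite le_measure ?inE// => w nw.
by apply: sub => /= h; apply: nw; exact: h.
Qed.

(** Under the mixture, the remainder, the mass of the atom and its position are almost surely
    [zeta], [1 - s] and [x], so the product measure makes the joint law factorize. *)
Lemma size_bias_law (A : set (sfmeas X R)) (B : set (\bar R)) (C : set X) :
  borel_space R X -> diffuse rho ->
  measurable A -> measurable B -> measurable C ->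
  P [set w | A (del_atom (zeta w) (tau w)) /\ B (zeta w [set tau w]) /\
    C (tau w)] =
  rho C * (beta [set s : measurableTypeR R | B (1 - s)%:E] * P (zeta @^-1` A)).
Proof.
move=> XR rhoD mA mB mC.
(* The condition of mass one is included because the atom and its removal are known to be measurable
   only on that set; it holds for every [zeta w] and for every mixture with [s] in the unit
   interval. *)
pose E : set (sfmeas X R * X)%type :=
  ([set z : (sfmeas X R * X)%type | z.1 setT = 1] `&` (fun z : (sfmeas X R *
    X)%type => del_atom z.1 z.2) @^-1` A) `&`
  ([set z : (sfmeas X R * X)%type | z.1 setT = 1] `&` (fun z : (sfmeas X R *
    X)%type => z.1 [set z.2]) @^-1` B) `&`
  snd @^-1` C.
have mD1 := @measurable_prob_sfmeas R _ X.
have mE : measurable E.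
  apply: measurableI; last first.
    have msnd : measurable_fun setT (@snd (sfmeas X R) X)
      by exact: measurable_snd.
    by rewrite -[X in measurable X]setTI; exact: msnd.
  apply: measurableI; first exact: measurable_del_atom.
  exact: measurable_atom.
pose c := P (zeta @^-1` A).
pose B' : set (measurableTypeR R) := [set s | B (1 - s)%:E].
have mB' : measurable B'.
  have m1 : measurable_fun setT (fun s : measurableTypeR R => (1 - s)%:E).
    by apply/measurable_EFinP; exact: measurable_funB.
  by rewrite -[X in measurable X]setTI; exact: m1.
have mzA : measurable (zeta @^-1` A).
  by rewrite -[X in measurable X]setTI; exact: mzeta.
have -> : [set w | A (del_atom (zeta w) (tau w)) /\ B (zeta w [set tau w]) /\
    C (tau w)] = [set w | E (zeta w, tau w)].
  apply/seteqP; split => w /=; last by move=> [[[_ ?] [_ ?]] ?].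
  by move=> [? [? ?]]; split => //; split; split => //; exact: zeta1.
rewrite -Q1E Q1Q2// Q2E//.
transitivity (\int[rho]_x ((\1_C x)%:E * (beta B' * c))); last first.
  rewrite ge0_integralZr//; last 2 first.
    exact/measurable_EFinP/measurable_indic.
    by rewrite mule_ge0// measure_ge0.
  by rewrite integral_indic// setIT.
apply: eq_integral => x _.
pose N := [set w | zeta w [set x] = 0].
have mx := borel_space_set1 XR x.
have PN : P (~` N) = 0 by exact: zeta_null.
have mN : measurable N.
  have mzx : measurable_fun setT (fun w => zeta w [set x]).
    exact: (measurableT_comp (measurable_sfmeas_ev mx) mzeta).
  rewrite -[X in measurable X]setTI.
  exact: (mzx measurableT [set 0] (emeasurable_set1 _)).
have PIN S : measurable S -> P S = P (S `&` N).
  move=> mS; rewrite (measureDI P mS mN) [X in X + _](_ : _ = 0) ?add0e//.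
  apply/eqP; rewrite eq_le measure_ge0 andbT -[leRHS]PN le_measure ?inE//.
  - exact: measurableD.
  - exact: measurableC.
(* Here the absolute values in [atom_mix] disappear. Since [s > 0], the normalizing factor of
   [del_atom] is a true inverse of [s]; at [s = 0] the convention for division by zero would give
   the zero measure. *)
have inner s : (0 < s <= 1)%R ->
    P [set w | E (atom_mix (zeta_fin w) s x, x)] =
    (\1_C x)%:E * c * (\1_B' s)%:E.
  move=> /andP[s0 s1].
  have mS : measurable [set w | E (atom_mix (zeta_fin w) s x, x)].
    have mHs : measurable_fun setT (fun w => H ((x, s), w)).
      by apply: (measurableT_comp mH).
    by rewrite -[X in measurable X]setTI; exact: (mHs measurableT).
  (* The conditions on [x] and [s], written as an event that is either everything or empty. *)
  pose W : set Omega := [set w | C x /\ B' s].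
  have mW : measurable W.
    have [h|h] := pselect (C x /\ B' s).
      by rewrite (_ : W = setT)//; apply/seteqP; split.
    by rewrite (_ : W = set0)//; apply/seteqP; split.
  have mixT w : atom_mix (zeta_fin w) s x setT = 1.
    rewrite atom_mixE diracT zeta1 !mule1 -EFinD !ger0_norm ?subr_ge0 ?(ltW
      s0)//.
    by rewrite addrC subrK.
  have mixx w : N w -> atom_mix (zeta_fin w) s x [set x] = (1 - s)%:E.
    move=> wN; rewrite atom_mixE wN mule0 add0e diracE mem_set// mule1.
    by rewrite ger0_norm// subr_ge0.
  have delE w : N w ->
      A (del_atom (atom_mix (zeta_fin w) s x) x) <-> A (zeta w).
    move=> wN; apply: sfmeas_ext => // U mU;
      rewrite del_atom_prob// (mixx _ wN).
    rewrite -[fine _]/(1 - s)%R subKr atom_mixE !ger0_norm ?subr_ge0 ?(ltW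
      s0)// addeK.
      by rewrite muleA -EFinM mulVf ?mul1e// gt_eqF.
    by rewrite fin_numM// diracE.
  have SN : [set w | E (atom_mix (zeta_fin w) s x, x)] `&` N =
      (zeta @^-1` A `&` W) `&` N.
    apply/seteqP; split=> w [+ wN].
      move=> [[[_ Az] [_ Bz]] Cx]; split => //; split; first exact/(delE _ wN).
      by split => //; rewrite /B'/= -(mixx _ wN).
    move=> [Az [Cx Bs]]; split; last exact: wN.
    split; last exact: Cx.
    split; split; [exact: mixT|exact/(delE _ wN)|exact: mixT|].
    by rewrite /preimage/= (mixx _ wN).
  rewrite (PIN _ mS) SN -PIN; last exact: measurableI.
  rewrite !indicE; have [xC|xC] := boolP (x \in C); last first.
    rewrite mul0e mul0e (_ : _ `&` W = set0) ?measure0//.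
    by apply/seteqP; split => w //= [_ [/mem_set]]; rewrite (negbTE xC).
  have [sB|sB] := boolP (s \in B'); last first.
    rewrite mule0 (_ : _ `&` W = set0) ?measure0//.
    by apply/seteqP; split => w //= [_ [_ /mem_set]]; rewrite (negbTE sB).
  rewrite mul1e mule1 /c; congr (P _); apply/seteqP; split => w; first by case.
  by move=> wA; split => //; split; exact/set_mem.
transitivity (\int[beta]_s ((\1_C x)%:E * c * (\1_B' s)%:E)).
  rewrite !ge0_integral_beta_measure//.
  - apply: eq_integral => s; rewrite inE/= in_itv/= => s01; congr (_ * _).
    exact: inner.
  - by move=> s; rewrite !mule_ge0// measure_ge0.
  - apply: emeasurable_funM => //; apply/measurable_EFinP.
    exact: measurable_indic.
  - exact: measurable_H_section.
rewrite ge0_integralZl//; last 2 first.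
- by apply/measurable_EFinP; exact: measurable_indic.
- by rewrite mule_ge0// measure_ge0.
by rewrite integral_indic// setIT -muleA (muleC c).
Qed.

End size_biased.

(** * Equality in distribution and independence *)

Theorem theorem6p1 (R : realType)
    (d : measure_display) (X : measurableType d)
    (rho : {measure set X -> \bar R})
    (dO : measure_display) (Omega : measurableType dO)
    (P : probability Omega R)
    (zeta : {RV P >-> sfmeas X R}) (tau : {RV P >-> X}) :
  borel_space R X ->
  diffuse rho ->
  0 < rho setT -> rho setT < +oo ->
  (forall w, zeta w setT = 1) ->
  is_dirichlet_process P rho zeta ->
  (forall B, measurable B ->
     is_cond_prob P (tau @^-1` B) zeta (fun w => zeta w B)) ->
  [/\ measurable_fun setT (fun w => del_atom (zeta w) (tau w)),
      measurable_fun setT (fun w => zeta w [set tau w]),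
      eq_dist P (fun w => del_atom (zeta w) (tau w)) zeta &
      independent3 P (fun w => del_atom (zeta w) (tau w))
        (fun w => zeta w [set tau w]) tau].
Proof.
move=> XR rhoD rho0 rhoy zeta1 zetaD tauE.
have rho_fin : fin_num_fun rho by exact: lty_fin_num_fun.
have rho_sigma : sigma_finite setT rho.
  by apply: fin_num_fun_sigma_finite => //; rewrite measure0 ltry.
pose H1 := isFinite.Build _ _ _ _ rho_fin.
pose H2 := isSFinite.Build _ _ _ _ (sfinite_measure_sigma_finite rho_sigma).
pose H3 := isSigmaFinite.Build _ _ _ _ rho_sigma.
pose frho := HB.pack_for (FiniteMeasure.type X R) (Measure.sort rho) H1 H2 H3.
have mzeta : measurable_fun setT zeta by exact: measurable_funPT.
have mtau : measurable_fun setT tau by exact: measurable_funPT.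
have mZ : measurable_fun setT (fun w => (zeta w, tau w)).
  exact: measurable_fun_pair.
have mD1 := @measurable_prob_sfmeas R _ X.
have mdel : measurable_fun setT (fun w => del_atom (zeta w) (tau w)).
  apply: (measurable_comp mD1 _ (measurable_del_atom XR) mZ).
  by move=> _ [w _ <-] /=; exact: zeta1.
have matom : measurable_fun setT (fun w => zeta w [set tau w]).
  apply: (measurable_comp mD1 _ (measurable_atom XR) mZ).
  by move=> _ [w _ <-] /=; exact: zeta1.
pose beta := @size_bias_measure R d X frho rho0.
have law A B C := @size_bias_law R d X frho dO Omega P zeta tau mzeta mtau rho0
  zeta1 zetaD tauE A B C XR rhoD.
rewrite -[size_bias_measure _]/beta in law.
rewrite -[Measure.sort frho]/(Measure.sort rho) in law.
have betaT : [set s : measurableTypeR R | [set: \bar R] (1 - s)%:E] = setT.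
  by apply/seteqP; split.
(* The joint law on the whole spaces yields the normalization; the product of the three marginals
   exceeds the joint law by exactly this factor. *)
have mass : beta setT * rho setT = 1.
  have := law setT setT setT measurableT measurableT measurableT.
  rewrite !preimage_setT (_ : mkset _ = setT); last by apply/seteqP; split.
  by rewrite !probability_setT mule1 muleC => <-.
have lawA A : measurable A ->
    P ((fun w => del_atom (zeta w) (tau w)) @^-1` A) = P (zeta @^-1` A).
  move=> mA; have := law A setT setT mA measurableT measurableT.
  rewrite betaT muleA (muleC _ (beta setT)) mass mul1e => <-.
  by congr (P _); apply/seteqP; split => [w Aw|w []].
split; [exact: mdel|exact: matom|by move=> A; exact: lawA|].
move=> A B C mA mB mC.
have lawB : P ((fun w => zeta w [set tau w]) @^-1` B) =
    rho setT * beta [set s : measurableTypeR R | B (1 - s)%:E].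
  have := law setT B setT measurableT mB measurableT.
  rewrite preimage_setT probability_setT mule1 => <-.
  by congr (P _); apply/seteqP; split => [w Bw|w [_ []]].
have lawC : P (tau @^-1` C) = rho C * beta setT.
  have := law setT setT C measurableT measurableT mC.
  rewrite betaT preimage_setT probability_setT mule1 => <-.
  by congr (P _); apply/seteqP; split => [w Cw|w [_ []]].
rewrite lawA// lawB lawC.
have -> : (fun w => del_atom (zeta w) (tau w)) @^-1` A `&`
    (fun w => zeta w [set tau w]) @^-1` B `&` tau @^-1` C =
    [set w | A (del_atom (zeta w) (tau w)) /\ B (zeta w [set tau w]) /\
      C (tau w)].
  by apply/seteqP; split => [w [[]]|w [? []]].
rewrite law//; set b := beta [set s | _]; set z := P _.
by rewrite muleACA (muleC (rho setT)) -(muleA b) (muleC (rho setT)) mass mule1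
  muleA (muleC _ z) muleA.
Qed.
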